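(* Let $f\in\mathcal{D}$ and let $U_{f}:L^{2}(0,1)\to L^{2}(\mathbb{R})$, $U_{f}g=(g\circ F)\sqrt{f}$. Then: (i) $U_{f}$ is an isometry; if $f\in\mathcal{D}_{+}$ it is unitary onto $L^{2}(\operatorname{supp}f)$, with inverse $\psi\mapsto(\psi\circ Q)\sqrt{Q'}$. (ii) For every unit vector $g\in L^{2}(0,1)$, $|U_{f}g|^{2}=\rho_{|g|^{2}}[f]$, and the family $\{\rho_{v}[f]:v\in\mathcal{W}\}$ is exactly the set of squared moduli $|U_{f}g|^{2}$ of the images of unit vectors $g\in L^{2}(0,1)$. In particular $\rho_{w_{k}}[f]=|\psi_{k}[f]|^{2}$, where $\psi_{k}[f]:=U_{f}\varphi_{k}$, and for $f\in\mathcal{D}_{+}$ the family $\{\psi_{k}[f]\}_{k\ge1}$ is an orthonormal basis of $L^{2}(\operatorname{supp}f)$ (for general $f\in\mathcal{D}$ the support is read as $\{f>0\}$ modulo null sets). (iii) For every increasing differentiable homeomorphism $T$ with positive derivative, from an open interval containing the support of $f$ onto an open interval, $$U_{T_{\#}f}=V_{T}\,U_{f},\qquad V_{T}\psi=(\psi\circ T^{-1})\sqrt{|(T^{-1})'|};$$ for decreasing $T$ (differentiable homeomorphism with nonvanishing derivative), $U_{T_{\#}f}=V_{T}\,U_{f}R$ with $(Rg)(z)=g(1-z)$.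
   Context: $\mathcal{D}$ is the set of probability densities in $L^{1}(\mathbb{R})$; $F(x)=\int_{-\infty}^{x}f$. $\mathcal{D}_{+}\subset\mathcal{D}$ is the set of densities continuous and strictly positive on an open interval and vanishing outside it; for $f\in\mathcal{D}_{+}$, $Q=F^{-1}$ on $(0,1)$. $\mathcal{W}$ is the set of kernels, i.e. probability densities on $[0,1]$, and $\rho_{v}[f]=v(F)f$ for $v\in\mathcal{W}$. $\varphi_{k}(z)=\sqrt{2}\sin(k\pi z)$, $w_{k}(z)=2\sin^{2}(k\pi z)$, $k=1,2,\ldots$. $T_{\#}f$ is the density of the pushforward of the law $f$ under $T$. Functions $(\psi\circ T^{-1})\sqrt{|(T^{-1})'|}$ are extended by zero outside the image of $T$. *)

(* Defs.v *)
From HB Require Import structures.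
From mathcomp Require Import all_boot all_order all_algebra.
From mathcomp Require Import all_classical all_reals all_analysis.
From mathcomp Require Export complex.

Set Implicit Arguments.
Unset Strict Implicit.
Unset Printing Implicit Defensive.

Import Order.TTheory GRing.Theory Num.Theory.
Import numFieldNormedType.Exports.

Local Open Scope classical_set_scope.
Local Open Scope complex_scope.
Local Open Scope ring_scope.

(* Elements of L^1 and L^2 are represented by Borel functions R -> R and
   R -> R[i].  Equality is equality almost everywhere, and a function "on A"
   is constrained on A only. *)

Section L2.
Context {R : realType}.
Implicit Types (A B : set R) (g h psi : R -> R[i]) (U V : (R -> R[i]) -> R -> R[i]).
Local Notation mu := (@lebesgue_measure R).

Definition abs2 (z : R[i]) : R := ComplexField.Normc.normc z ^+ 2.

Definition cmeasurable A g : Prop :=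
  measurable_fun A (fun x => complex.Re (g x)) /\
  measurable_fun A (fun x => complex.Im (g x)).

Definition L2 A g : Prop :=
  cmeasurable A g /\ (\int[mu]_(x in A) (abs2 (g x))%:E < +oo)%E.

Definition cintegral A h : R[i] :=
  (\int[mu]_(x in A) complex.Re (h x))%R +i* (\int[mu]_(x in A) complex.Im (h x))%R.

Definition L2inner A g h : R[i] := cintegral A (fun x => g x * (h x)^*).

Definition L2norm A g : R := Num.sqrt (\int[mu]_(x in A) abs2 (g x))%R.

Definition unit_vector A g : Prop := L2 A g /\ L2norm A g = 1.

(* U is a well-defined linear operator from L^2(A) to L^2(B) *)
Definition L2_linear A B U : Prop :=
  [/\ forall g, L2 A g -> L2 B (U g),
      forall g h, L2 A g -> L2 A h ->
        ae_eq mu A g h -> ae_eq mu B (U g) (U h)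
    & forall (a : R[i]) g h, L2 A g -> L2 A h ->
        ae_eq mu B (U (fun z => a * g z + h z))
                   (fun x => a * U g x + U h x)].

Definition L2_isometry A B U : Prop :=
  L2_linear A B U /\ forall g, L2 A g -> L2norm B (U g) = L2norm A g.

Definition L2_unitary A B U : Prop :=
  [/\ L2_linear A B U,
      forall g h, L2 A g -> L2 A h -> L2inner B (U g) (U h) = L2inner A g h
    & forall psi, L2 B psi -> exists2 g, L2 A g & ae_eq mu B (U g) psi].

Definition L2_inverse A B U V : Prop :=
  [/\ L2_linear B A V,
      forall g, L2 A g -> ae_eq mu A (V (U g)) g
    & forall psi, L2 B psi -> ae_eq mu B (U (V psi)) psi].

Definition orthonormal_basis A (e : nat -> R -> R[i]) : Prop :=
  [/\ forall k, L2 A (e k),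
      forall j k, L2inner A (e j) (e k) = (j == k)%:R
    & forall psi, L2 A psi -> forall eps : R, 0 < eps ->
        exists (n : nat) (c : nat -> R[i]),
          L2norm A (fun x => psi x - \sum_(k < n) c k * e k x) < eps].

End L2.

Section Densities.
Context {R : realType}.
Implicit Types (f h v : R -> R) (g psi : R -> R[i]) (I J : set R) (T : R -> R).
Local Notation mu := (@lebesgue_measure R).

Definition density_on (A : set R) f : Prop :=
  [/\ measurable_fun A f, {ae mu, forall x, A x -> 0 <= f x}
    & (\int[mu]_(x in A) (f x)%:E = 1)%E].

Definition is_density f : Prop := density_on setT f.

Definition is_kernel f : Prop := density_on `[0, 1] f.

Definition open_interval I : Prop := open I /\ is_interval I.

Definition pos_density f : Prop :=
  is_density f /\
  exists I, [/\ open_interval I, {within I, continuous f},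
                forall x, I x -> 0 < f x & forall x, ~ I x -> f x = 0].

(* For a density that is positive exactly on an open interval, this is that
   interval; it differs from the closed support by at most its endpoints. *)
Definition supp f : set R := [set x | 0 < f x].

Definition cdf_of f (x : R) : R := (\int[mu]_(t in `]-oo, x]) f t)%R.

(* Inverse of the bijection F : supp f -> (0, 1), for f a pos_density. *)
Definition quantile_of f : R -> R := 'pinv_(fun=> 0) (supp f) (cdf_of f).

Definition rho v f (x : R) : R := v (cdf_of f x) * f x.

Definition Uop f g (x : R) : R[i] := g (cdf_of f x) * (Num.sqrt (f x))%:C.

Definition Uinv f psi (z : R) : R[i] :=
  psi (quantile_of f z) * (Num.sqrt (derive1 (quantile_of f) z))%:C.

Definition phi (k : nat) (z : R) : R[i] :=
  (Num.sqrt 2 * sin (k%:R * pi * z))%:C.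

Definition w (k : nat) (z : R) : R := 2 * sin (k%:R * pi * z) ^+ 2.

Definition psi_ f (k : nat) : R -> R[i] := Uop f (phi k).

(* T is only meaningful on I; so is its inverse on J = T(I). *)
Definition inv_on I T : R -> R := 'pinv_(fun=> 0) I T.

Definition diff_homeomorphism I J T : Prop :=
  [/\ set_bij I J T, {within I, continuous T},
      {within J, continuous (inv_on I T)}
    & forall x, I x -> derivable T x 1].

Definition increasing_on I T : Prop :=
  forall x y, I x -> I y -> x < y -> T x < T y.

Definition decreasing_on I T : Prop :=
  forall x y, I x -> I y -> x < y -> T y < T x.

(* h = T_# f for T defined on I; determined up to null sets. *)
Definition pushforward_density I T f h : Prop :=
  is_density h /\
  forall B : set R, measurable B ->
    (\int[mu]_(y in B) (h y)%:E = \int[mu]_(x in I `&` T @^-1` B) (f x)%:E)%E.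

Definition VT I J T psi (y : R) : R[i] :=
  if y \in J then
    psi (inv_on I T y) * (Num.sqrt `|derive1 (inv_on I T) y|)%:C
  else 0.

Definition reflection g (z : R) : R[i] := g (1 - z).

End Densities.

(* Main.v *)
Require Import Defs.
From HB Require Import structures.
From mathcomp Require Import all_boot all_order all_algebra.
From mathcomp Require Import all_classical all_reals all_analysis.
From mathcomp Require Import measurable_realfun ring lra.

Set Implicit Arguments.
Unset Strict Implicit.
Unset Printing Implicit Defensive.

Import Order.TTheory GRing.Theory Num.Theory.
Import numFieldNormedType.Exports.

Local Open Scope classical_set_scope.
Local Open Scope ring_scope.

(** The map [F] is the probability integral transform: under the law [f] it is
    uniformly distributed on (0, 1).  Hence
      int phi(F(x)) f(x) dx = int_0^1 phi(z) dz,
    and this one change of variables is behind parts (i) and (ii).  With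
    [phi = |g|^2] it says that [Uop f] preserves norms, because
    [|Uop f g|^2 = |g(F)|^2 f]; with the real and imaginary parts of [g h^*] it
    says that inner products are preserved; with indicators of null sets it says
    that [Uop f] respects equality almost everywhere.  The formula is proved for
    rays ([law_cdf_set]: the set where [F <= a] has mass [a]), extended to Borel
    sets by uniqueness of measures, and to functions by simple approximation
    ([law_cdf]).

    For a positive continuous density, [F] is a differentiable bijection from the
    support onto (0, 1), so [Q' = 1 / f(Q)] and [Uinv f] is a two-sided inverse
    pointwise; that it maps [L^2] to [L^2] is again the formula above.

    A kernel [v] is [|g|^2] for [g = sqrt v], which gives the family in (ii).
    Orthonormality of the [psi_k] is that of the sines.  Completeness is proved
    directly on [{f > 0}], for every density.  By the addition formulas the span
    of the [psi_k] is stable under multiplication by [cos(pi F)], hence by all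
    polynomials in it, and it contains [u = sin(pi F) sqrt f].  The polynomials
    [(1 - s^n)^(2^n)] converge boundedly on [0, 1] to the indicator of
    [s < 1/2]; composed with an affine function of [cos(pi F)] they show that the
    closure of the span contains [u] times the indicator of any ray
    ([adherent_ray]).  A pi-lambda argument passes to Borel sets, linearity and
    dominated convergence to everything square integrable where [u > 0]
    ([adherent_full]), and [u > 0] almost everywhere on [{f > 0}].

    For (iii), let [S] be the inverse of [T].  Where [y = T(x)], the distribution
    function of the transported law is [F(S(y))] if [T] increases and
    [1 - F(S(y))] if it decreases; the rest is that its density is [f(S) |S'|].
    As [S'] need not be continuous, this requires
      int_J phi |S'| = int_I phi(T)
    for a monotone [T] that is merely differentiable.  Fatou's lemma applied to
    difference quotients gives the inequality [<=]
    ([integral_derive_le_open]).  The same inequality for the inverse pair,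
    applied to [phi(T) |S'(T)|], is the converse one, since
    [|S'(T)| |T'| = 1] ([monotone_change_of_variables]). *)

(** * Integrals compared through their values on sets *)

Section integrals_from_sets.
Local Open Scope ereal_scope.
Context {R : realType}.
Local Notation mu := (@lebesgue_measure R).
Import HBNNSimple.

Let int_nnsfun (K : R -> R) (w : R -> R) (h : {nnsfun R >-> R}) :
  measurable_fun setT K -> measurable_fun setT w -> (forall x, 0 <= w x)%R ->
  \int[mu]_x ((h (K x))%:E * (w x)%:E) =
  \sum_(y \in range h) (y%:E * \int[mu]_(x in K @^-1` (h @^-1` [set y])) (w x)%:E).
Proof.
move=> mK mw w0.
have mp y : measurable (K @^-1` (h @^-1` [set y])).
  by rewrite -[X in measurable X]setTI; exact: mK.
have mwr y : measurable_fun setT ((EFin \o w) \_ (K @^-1` (h @^-1` [set y]))).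
  apply/(measurable_restrictT _ (mp y)); apply: measurable_funTS.
  exact/measurable_EFinP.
transitivity (\int[mu]_x \sum_(y \in range h)
    (y%:E * ((EFin \o w) \_ (K @^-1` (h @^-1` [set y]))) x)).
  apply: eq_integral => x _.
  have : (h (K x))%:E = \sum_(y \in range h) (y * \1_(h @^-1` [set y]) (K x))%:E.
    by rewrite fsumEFin// -fimfunE.
  move=> ->; rewrite ge0_mule_fsuml//; last first.
    by move=> y; rewrite EFinM nnfun_muleindic_ge0.
  apply: eq_fsbigr => y _.
  rewrite EFinM -muleA; congr (_ * _).
  rewrite patchE indicE/=.
  have -> : (K x \in h @^-1` [set y]) = (x \in K @^-1` (h @^-1` [set y])).
    by apply/idP/idP; rewrite !inE.
  by case: (x \in _); rewrite ?mul1e ?mul0e.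
rewrite ge0_integral_fsum//.
- apply: eq_fsbigr => y; rewrite inE => -[z _ <-].
  rewrite ge0_integralZl//; last 3 first.
  + exact: mwr.
  + by move=> x _; apply: erestrict_ge0 => t _; rewrite lee_fin.
  + by rewrite lee_fin.
  + by rewrite -integral_mkcond.
- move=> y; apply: emeasurable_funM => //.
  exact: mwr.
- move=> y x _; have [y0|y0] := leP 0%R y.
    by rewrite mule_ge0// ?lee_fin//; apply: erestrict_ge0 => t _; rewrite lee_fin.
  rewrite patchE; case: ifPn => [|]; last by rewrite mule0.
  by rewrite inE/= => hy; move: y0; rewrite -hy ltNge fun_ge0.
Qed.

Let le_int_nnsfun (K K' : R -> R) (w v : R -> R) (h : {nnsfun R >-> R}) :
  measurable_fun setT K -> measurable_fun setT K' ->
  measurable_fun setT w -> measurable_fun setT v ->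
  (forall x, 0 <= w x)%R -> (forall x, 0 <= v x)%R ->
  (forall B, measurable B ->
    \int[mu]_(x in K @^-1` B) (w x)%:E <= \int[mu]_(x in K' @^-1` B) (v x)%:E) ->
  \int[mu]_x ((h (K x))%:E * (w x)%:E) <= \int[mu]_x ((h (K' x))%:E * (v x)%:E).
Proof.
move=> mK mK' mw mv w0 v0 wv.
rewrite !int_nnsfun// lee_fsum//.
move=> y [z _ <-]; rewrite lee_wpmul2l ?lee_fin//.
exact: wv.
Qed.

(** Both sides are integrals of [phi] against image measures, those of [w] under
    [K] and of [v] under [K'].  Keeping maps and weights instead of measures lets
    one statement serve the law of a distribution function, where [K'] is the
    identity, and changes of variables, where [K] is. *)
Lemma le_integral_of_sets (K K' : R -> R) (w v : R -> R) (phi : R -> \bar R) :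
  measurable_fun setT K -> measurable_fun setT K' ->
  measurable_fun setT w -> measurable_fun setT v ->
  (forall x, 0 <= w x)%R -> (forall x, 0 <= v x)%R ->
  (forall B, measurable B ->
    \int[mu]_(x in K @^-1` B) (w x)%:E <= \int[mu]_(x in K' @^-1` B) (v x)%:E) ->
  measurable_fun setT phi -> (forall x, 0 <= phi x) ->
  \int[mu]_x (phi (K x) * (w x)%:E) <= \int[mu]_x (phi (K' x) * (v x)%:E).
Proof.
move=> mK mK' mw mv w0 v0 wv mphi phi0.
pose h := nnsfun_approx measurableT mphi.
have cvgh (K0 w0' : R -> R) : measurable_fun setT K0 -> measurable_fun setT w0' ->
    (forall x, 0 <= w0' x)%R ->
    \int[mu]_x ((h n (K0 x))%:E * (w0' x)%:E) @[n --> \oo] -->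
    \int[mu]_x (phi (K0 x) * (w0' x)%:E).
  move=> mK0 mw0 w00.
  have -> : (fun x => phi (K0 x) * (w0' x)%:E) =
      (fun x => limn (fun n => (h n (K0 x))%:E * (w0' x)%:E)).
    apply/funext => x; apply/esym/cvg_lim => //.
    by apply: cvgeZr => //; apply: cvg_nnsfun_approx.
  apply: cvg_monotone_convergence => //.
  - move=> n; apply: emeasurable_funM; apply/measurable_EFinP => //.
    exact: measurableT_comp.
  - by move=> n x _; rewrite mule_ge0// lee_fin.
  - move=> x _ p q pq; rewrite lee_wpmul2r ?lee_fin//.
    exact/lefP/nd_nnsfun_approx.
have c1 := cvgh _ _ mK mw w0; have c2 := cvgh _ _ mK' mv v0.
rewrite -(cvg_lim _ c1)// -(cvg_lim _ c2)//.
apply: lee_lim; [exact: cvgP c1|exact: cvgP c2|].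
by apply: nearW => n; exact: le_int_nnsfun.
Qed.

Lemma eq_integral_of_sets (K K' : R -> R) (w v : R -> R) (phi : R -> \bar R) :
  measurable_fun setT K -> measurable_fun setT K' ->
  measurable_fun setT w -> measurable_fun setT v ->
  (forall x, 0 <= w x)%R -> (forall x, 0 <= v x)%R ->
  (forall B, measurable B ->
    \int[mu]_(x in K @^-1` B) (w x)%:E = \int[mu]_(x in K' @^-1` B) (v x)%:E) ->
  measurable_fun setT phi -> (forall x, 0 <= phi x) ->
  \int[mu]_x (phi (K x) * (w x)%:E) = \int[mu]_x (phi (K' x) * (v x)%:E).
Proof.
move=> mK mK' mw mv w0 v0 wv mphi phi0.
by apply/eqP; rewrite eq_le !le_integral_of_sets// => B mB; rewrite wv.
Qed.

End integrals_from_sets.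

(** * The law of the distribution function *)

(** An instance, so that [filterS] applies to almost-everywhere statements. *)
Lemma ae_mu_filter (R : realType) :
  Filter (nbhs (almost_everywhere (@lebesgue_measure R))).
Proof. exact: ae_filter_ringOfSetsType. Qed.
#[global] Existing Instance ae_mu_filter.

(** The image of [w dx] under [K] is made a measure, so that uniqueness of
    measures applies to it. *)
Section image_law.
Local Open Scope ereal_scope.
Context {R : realType} (K w : R -> R).
Hypotheses (mK : measurable_fun setT K) (mw : measurable_fun setT w)
  (w0 : forall x, (0 <= w x)%R).
Local Notation mu := (@lebesgue_measure R).

Definition image_law (B : set (measurableTypeR R)) : \bar R :=
  \int[mu]_(x in K @^-1` B) (w x)%:E.

Let image_law0 : image_law set0 = 0.
Proof. by rewrite /image_law preimage_set0 integral_set0. Qed.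

Let image_law_ge0 B : 0 <= image_law B.
Proof. by apply: integral_ge0 => x _; rewrite lee_fin. Qed.

Let image_law_sigma_additive : semi_sigma_additive image_law.
Proof.
move=> /= A mA tA mUA.
have mKA n : measurable (K @^-1` (A n)).
  by rewrite -[X in measurable X]setTI; exact: (mK measurableT (mA n)).
rewrite /image_law preimage_bigcup ge0_integral_bigcup//=.
- apply: is_cvg_ereal_nneg_natsum_cond => n _ _; exact: image_law_ge0.
- by apply: measurable_funTS; exact/measurable_EFinP.
- by move=> x _; rewrite lee_fin.
- apply/trivIsetP => i j _ _ ij; rewrite -preimage_setI.
  by move/trivIsetP : tA => /(_ i j Logic.I Logic.I ij) ->; rewrite preimage_set0.
Qed.

HB.instance Definition _ := isMeasure.Build _ _ _
  image_law image_law0 image_law_ge0 image_law_sigma_additive.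

Definition image_measure : {measure set (measurableTypeR R) -> \bar R} := image_law.

End image_law.

Section density_basics.
Context {R : realType}.
Local Notation mu := (@lebesgue_measure R).

Lemma eq_sets_of_rays (K K' w v : R -> R) :
  measurable_fun setT K -> measurable_fun setT K' ->
  measurable_fun setT w -> measurable_fun setT v ->
  (forall x, 0 <= w x) -> (forall x, 0 <= v x) ->
  (\int[mu]_x (w x)%:E < +oo)%E ->
  (forall a : R, \int[mu]_(x in K @^-1` `]-oo, a]) (w x)%:E =
                 \int[mu]_(x in K' @^-1` `]-oo, a]) (v x)%:E)%E ->
  forall B, measurable B ->
  (\int[mu]_(x in K @^-1` B) (w x)%:E = \int[mu]_(x in K' @^-1` B) (v x)%:E)%E.
Proof.
move=> mK mK' mw mv w0 v0 woo rays B mB.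
pose G := [set A : set R | exists a, A = `]-oo, a]%classic].
apply: (@measure_unique _ R (measurableTypeR R) G
  (fun n : nat => `]-oo, n%:R]%classic) _ _ _ _
  (image_measure mK mw w0) (image_measure mK' mv v0)) => //=.
- rewrite RGenOInfty.measurableE eqEsubset; split => A.
    apply: smallest_sub; first exact: smallest_sigma_algebra.
    move=> _ [x ->]; rewrite -setCitvl.
    have [s0 sC _] := @smallest_sigma_algebra _ setT G.
    by rewrite -setTD; apply: sC; apply: sub_sigma_algebra; exists x.
  apply: smallest_sub; first exact: smallest_sigma_algebra.
  move=> _ [x ->]; rewrite -setCitvr.
  have [s0 sC _] := @smallest_sigma_algebra _ setT (@RGenOInfty.G R).
  by rewrite -setTD; apply: sC; apply: sub_sigma_algebra; exists x.
- move=> _ _ [x ->] [y ->]; exists (Num.min x y).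
  by apply/seteqP; split => z /=; rewrite !in_itv/= le_min => /andP.
- by move=> i; exists i%:R.
- apply/seteqP; split => // x _; exists (Num.truncn `|x|).+1 => //=.
  by rewrite in_itv/= (le_trans (ler_norm _))// ltW// truncnS_gt.
- by move=> _ [a ->]; exact: rays.
- move=> k; apply: le_lt_trans woo.
  apply: ge0_subset_integral => //.
  + by rewrite -[X in measurable X]setTI; exact: mK.
  + exact/measurable_EFinP.
  + by move=> x _; rewrite lee_fin.
Qed.

(** The values at the two endpoints are arbitrary, but every function on a
    singleton is measurable. *)
Lemma measurable_fun_cc01 d (T : measurableType d) (g : R -> T) :
  measurable_fun (`]0%R, 1%R[%classic : set R) g ->
  measurable_fun (`[0%R, 1%R]%classic : set R) g.
Proof.
move=> mg.
have <- : 0 |` (`]0%R, 1%R[ `|` [set 1]) = `[0%R, 1%R]%classic :> set R.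
  by rewrite setUitv1 ?setU1itv// bnd_simp.
apply/measurable_funU => //; first exact: measurableU.
split; first exact: measurable_fun_set1.
by apply/measurable_funU => //; split => //; exact: measurable_fun_set1.
Qed.

(** A density is nonnegative only almost everywhere.  Its positive part is a
    nonnegative representative, with the same [Num.sqrt] at every point since
    [Num.sqrt] vanishes on negative numbers. *)
Definition pospart (f : R -> R) (x : R) := Num.max (f x) 0.

Lemma pospart_ge0 f x : 0 <= pospart f x.
Proof. by rewrite le_max lexx orbT. Qed.

Lemma measurable_pospart f : measurable_fun setT f ->
  measurable_fun setT (pospart f).
Proof. by move=> mf; apply: measurable_maxr. Qed.

Lemma sqrt_pospart f x : Num.sqrt (pospart f x) = Num.sqrt (f x).
Proof.
rewrite /pospart; have [f0|f0] := ltP (f x) 0; last by [].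
by rewrite sqrtr0 ler0_sqrtr// ltW.
Qed.

Lemma sqr_sqrt_pospart f x : Num.sqrt (f x) ^+ 2 = pospart f x.
Proof. by rewrite -sqrt_pospart sqr_sqrtr// pospart_ge0. Qed.

Section density.
Variables (f : R -> R) (hf : is_density f).
Local Notation fp := (pospart f).
Local Notation F := (cdf_of f).

Lemma density_measurable : measurable_fun setT f.
Proof. by case: hf. Qed.
Let mf := density_measurable.
Let mfp := measurable_pospart mf.
Let mfpE (A : set R) : measurable_fun A (EFin \o fp).
Proof. by apply: measurable_funTS; exact/measurable_EFinP. Qed.

#[local] Hint Extern 0 (is_true (0 <= pospart _ _)%R) =>
  solve [exact: pospart_ge0] : core.
#[local] Hint Extern 0 (measurable_fun _ _) => solve [exact: mfpE] : core.
#[local] Hint Extern 0 (is_true (0%R <= _)%E) =>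
  solve [by rewrite /= lee_fin pospart_ge0] : core.

Lemma density_ae_pospart : ae_eq mu setT f fp.
Proof.
have [_ f0 _] := hf; apply: (filterS _ f0) => x /(_ Logic.I) fx0 _.
by rewrite /pospart max_l.
Qed.

Lemma integral_pospart (A : set R) : measurable A ->
  (\int[mu]_(x in A) (f x)%:E = \int[mu]_(x in A) (fp x)%:E)%E.
Proof.
move=> mA; apply: ae_eq_integral => //.
- by apply: measurable_funTS; exact/measurable_EFinP.
- by move: density_ae_pospart; apply: filterS => x /(_ Logic.I) /= ->.
Qed.

Lemma integral_pospartT : (\int[mu]_x (fp x)%:E = 1)%E.
Proof. by rewrite -integral_pospart//; case: hf. Qed.

Lemma integrable_pospart (A : set R) : measurable A ->
  mu.-integrable A (EFin \o fp).
Proof.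
move=> mA; apply/integrableP; split => //.
under eq_integral do rewrite /= ger0_norm ?pospart_ge0//.
rewrite (@le_lt_trans _ _ 1%E) ?ltry//.
rewrite -integral_pospartT; apply: ge0_subset_integral => //.
Qed.

Lemma EFin_cdf x : ((F x)%:E = \int[mu]_(t in `]-oo, x]) (fp t)%:E)%E.
Proof.
rewrite /cdf_of /Rintegral integral_pospart// fineK//.
by apply: integrable_fin_num => //; exact: integrable_pospart.
Qed.

Lemma cdf_Rintegral x : F x = (\int[mu]_(t in `]-oo, x]) fp t)%R.
Proof. by rewrite /Rintegral -EFin_cdf. Qed.

Lemma cdf_nd : {homo F : x y / x <= y}.
Proof.
move=> x y xy; rewrite -lee_fin !EFin_cdf.
apply: ge0_subset_integral => //.
by apply: subset_itvl; rewrite bnd_simp.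
Qed.

Lemma cdf_ge0 x : 0 <= F x.
Proof.
rewrite -lee_fin EFin_cdf; apply: integral_ge0 => z _.
by rewrite lee_fin pospart_ge0.
Qed.

Lemma cdf_le1 x : F x <= 1.
Proof.
rewrite -lee_fin EFin_cdf -integral_pospartT; apply: ge0_subset_integral => //.
Qed.

Lemma cdf_measurable : measurable_fun setT F.
Proof. by apply: nondecreasing_measurable => //; exact: cdf_nd. Qed.

Lemma cdfD a x : a <= x ->
  F x = F a + parameterized_integral mu a x fp.
Proof.
move=> ax; rewrite !cdf_Rintegral /parameterized_integral.
have iT := integrable_pospart (measurable_itv `]-oo, x]).
have := Rintegral_itvB iT (_ : (-oo <= BRight a)%O) (_ : (BRight a <= BRight x)%O).
rewrite Rintegral_itv_obnd_cbnd => [<- //|]; first by rewrite subrKC.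
exact: integrable_pospart.
Qed.

Lemma cdf_continuous : continuous F.
Proof.
move=> x; pose a := x - 1; pose b := x + 1.
have ax : a < x by rewrite /a; lra.
have xb : x < b by rewrite /b; lra.
have ab : a < b by lra.
have := parameterized_integral_continuous (ltW ab)
  (integrable_pospart (measurable_itv `[a, b])).
rewrite continuous_within_itvP//= => -[+ _ _] => /(_ x).
rewrite in_itv/= ax xb => /(_ isT) cx.
apply: (@cvg_trans _ ((F a + parameterized_integral mu a y fp) @[y --> x])).
  apply: near_eq_cvg; near=> y; apply/esym/cdfD.
  by apply: ltW; near: y; exact: lt_nbhsr.
rewrite (cdfD (ltW ax)).
exact: (cvgD (cvg_cst _) cx).
Unshelve. all: by end_near. Qed.

Lemma integral_pospart_ray x :
  (\int[mu]_(t in `]x, +oo[) (fp t)%:E = (1 - F x)%:E)%E.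
Proof.
have : (\int[mu]_t (fp t)%:E = (F x)%:E + \int[mu]_(t in `]x, +oo[) (fp t)%:E)%E.
  rewrite EFin_cdf -ge0_integral_setU//.
  - by rewrite itv_setU_setT.
  - exact: disjoint_rays.
rewrite integral_pospartT EFinB => ->.
by rewrite addeAC subee ?add0e.
Qed.

(** Stated for increasing sets in order to serve both ends of the line. *)
Let mass_exhaust (A : (set R)^nat) (c : R) :
  nondecreasing_seq A -> (forall n, measurable (A n)) -> \bigcup_n A n = setT ->
  c < 1 -> exists n, (c%:E < \int[mu]_(x in A n) (fp x)%:E)%E.
Proof.
move=> ndA mA UA c1; apply: contrapT => /forallNP h.
have cv1 : (\int[mu]_(x in A n) (fp x)%:E @[n --> \oo] -->
    \int[mu]_(x in \bigcup_n A n) (fp x)%:E)%E.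
  by apply: ge0_nondecreasing_set_cvg_integral => //.
rewrite UA integral_pospartT in cv1.
have : (1 <= c%:E)%E; last by rewrite lee_fin leNgt c1.
rewrite -(cvg_lim _ cv1)//; apply: lime_le; first exact: cvgP cv1.
by apply: nearW => n; rewrite leNgt; apply/negP; exact: h.
Qed.

Lemma cdf_attained z : 0 < z < 1 -> exists x, F x = z.
Proof.
move=> /andP[z0 z1].
have [n zn] : exists n : nat, z < F n%:R.
  have [||||n] := @mass_exhaust (fun n : nat => `]-oo, n%:R]%classic) z.
  - apply/nondecreasing_seqP => n; apply/subsetPset; apply: subset_itvl.
    by rewrite bnd_simp ler_nat.
  - by [].
  - apply/seteqP; split => // x _; exists (Num.truncn x).+1 => //=.
    by rewrite in_itv/= ltW// truncnS_gt.
  - by [].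
  - by rewrite -EFin_cdf lte_fin; exists n.
have [m zm] : exists n : nat, F (- n%:R) < z.
  have [||||k] := @mass_exhaust (fun n : nat => `](- n%:R), +oo[%classic) (1 - z).
  - apply/nondecreasing_seqP => k; apply/subsetPset; apply: subset_itvr.
    by rewrite bnd_simp lerN2 ler_nat.
  - by [].
  - apply/seteqP; split => // x _; exists (Num.truncn (- x)).+1 => //=.
    by rewrite in_itv/= andbT ltrNl truncnS_gt.
  - by rewrite ltrBlDr ltrDl.
  - by rewrite integral_pospart_ray lte_fin ltrD2l ltrN2; exists k.
have nm : - m%:R <= n%:R :> R by rewrite (@le_trans _ _ 0)// oppr_le0.
have [||x _ <-] := @IVT R F (- m%:R) n%:R z nm.
- by apply: continuous_subspaceT; exact: cdf_continuous.
- by rewrite min_l ?max_r ?cdf_nd// !ltW.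
- by exists x.
Qed.

Let measurable_cdf_le a : measurable [set x | F x <= a].
Proof.
rewrite -[X in measurable X]setTI.
have -> : [set x | F x <= a] = F @^-1` `]-oo, a].
  by apply/seteqP; split => x /=; rewrite in_itv.
exact: cdf_measurable.
Qed.

(** The set [F <= a] need not be cut out by a prescribed point when [F] has flat
    pieces, so its mass is squeezed: it contains the ray ending at a solution of
    [F b = a] if [a > 0], and is contained in the ray ending at a solution of [F b = d], for
    every [d] slightly above [a]. *)
Let mass_cdf_le (a : R) : 0 <= a < 1 ->
  (\int[mu]_(x in [set x | F x <= a]%R) (fp x)%:E = a%:E)%E.
Proof.
move=> /andP[a0 a1]; apply/eqP; rewrite eq_le; apply/andP; split.
  apply/lee_addgt0Pr => e e0.
  pose d := Num.min (a + e) ((a + 1) / 2).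
  have ad : a < d by rewrite lt_min; apply/andP; split; lra.
  have d1 : d < 1 by rewrite gt_min; apply/orP; right; lra.
  have [|b Fb] := @cdf_attained d; first by rewrite d1 (le_lt_trans a0 ad).
  rewrite (@le_trans _ _ d%:E)//; last first.
    by rewrite -EFinD lee_fin ge_min lexx.
  rewrite -Fb EFin_cdf; apply: ge0_subset_integral => //.
    exact: measurable_cdf_le.
  move=> x Fxa; rewrite /= in_itv/= leNgt; apply/negP => /ltW /cdf_nd.
  by rewrite Fb leNgt (le_lt_trans Fxa).
have [<-|a0'] : 0 = a \/ 0 < a.
- by move: a0; rewrite [0 <= a]le_eqVlt => /orP[/eqP|]; [left|right].
- exact: integral_ge0.
have [|b Fb] := @cdf_attained a; first by rewrite a0' a1.
rewrite -{1}Fb EFin_cdf; apply: ge0_subset_integral => //.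
  exact: measurable_cdf_le.
by move=> x /=; rewrite in_itv/= => /cdf_nd; rewrite Fb.
Qed.

(** Both sides are finite measures of [B], so rays are enough. *)
Lemma law_cdf_set (B : set R) : measurable B ->
  (\int[mu]_(x in F @^-1` B) (fp x)%:E = mu (B `&` `]0%R, 1%R[))%E.
Proof.
move=> mB; pose v : R -> R := \1_(`]0%R, 1%R[%classic).
have vE (A : set R) : measurable A ->
    (\int[mu]_(x in idfun @^-1` A) (v x)%:E = mu (A `&` `]0%R, 1%R[))%E.
  move=> mA; rewrite preimage_id setIC; exact: integral_indic.
rewrite -vE//; apply: (@eq_sets_of_rays F idfun fp v) => //.
- exact: cdf_measurable.
- exact: measurable_id.
- exact: measurable_indic.
- by rewrite integral_pospartT ltry.
- move=> a; rewrite vE//.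
  have -> : F @^-1` `]-oo, a] = [set x | F x <= a].
    by apply/seteqP; split => x /=; rewrite in_itv.
  have [a0|a0] := ltP a 0.
    rewrite (_ : [set x | _] = set0) ?integral_set0; last first.
      by apply/seteqP; split => x //= /le_lt_trans/(_ a0); rewrite ltNge cdf_ge0.
    rewrite (_ : _ `&` _ = set0) ?measure0//.
    apply/seteqP; split => x //= []; rewrite !in_itv/= => xa /andP[x0 _].
    by move: a0; rewrite ltNge (le_trans (ltW x0) xa).
  have [a1|a1] := ltP a 1.
    rewrite mass_cdf_le ?a0//.
    rewrite (_ : _ `&` _ = `]0, a]%classic).
      by rewrite lebesgue_measure_itv/= lte_fin; case: ltP => a0'; rewrite ?sube0//;
        congr EFin; apply/eqP; rewrite eq_le a0 a0'.
    apply/seteqP; split => x /=; rewrite !in_itv/=.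
      by move=> [-> /andP[->]].
    by move=> /andP[-> xa]; rewrite xa (le_lt_trans xa).
  rewrite (_ : [set x | _] = setT) ?integral_pospartT; last first.
    by apply/seteqP; split => x //= _; rewrite (le_trans (cdf_le1 _)).
  rewrite (_ : _ `&` _ = `]0%R, 1%R[%classic).
    by rewrite lebesgue_measure_itv/= lte01 sube0.
  apply/seteqP; split => x /=; rewrite !in_itv/=; first by case.
  by move=> /andP[-> x1]; rewrite x1 (le_trans (ltW x1)).
Qed.

Lemma law_cdfT (phi : R -> \bar R) :
  measurable_fun setT phi -> (forall z, 0 <= phi z)%E ->
  (\int[mu]_x (phi (F x) * (fp x)%:E) = \int[mu]_(z in `]0%R, 1%R[) phi z)%E.
Proof.
move=> mphi phi0; pose v : R -> R := \1_(`]0%R, 1%R[%classic).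
rewrite (@eq_integral_of_sets R F idfun fp v)//.
- rewrite [RHS]integral_mkcond; apply: eq_integral => x _ /=.
  by rewrite patchE /v indicE; case: (x \in _); rewrite ?mule1 ?mule0.
- exact: cdf_measurable.
- exact: measurable_id.
- exact: measurable_indic.
- move=> B mB; rewrite law_cdf_set// preimage_id setIC; apply/esym.
  exact: integral_indic.
Qed.

(** The levels violating [P], or outside (0, 1), form a null set on (0, 1); its
    preimage has no mass for [f], hence is null where [f] is positive. *)
Lemma ae_cdf (P : R -> Prop) :
  {ae mu, forall z, `]0%R, 1%R[%classic z -> P z} ->
  {ae mu, forall x, 0 < f x -> `]0%R, 1%R[%classic (F x) /\ P (F x)}.
Proof.
move=> [N [mN N0 PN]].
pose B := ~` `]0%R, 1%R[%classic `|` N.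
have mB : measurable B by apply: measurableU => //; exact: measurableC.
have mFB : measurable (F @^-1` B).
  by rewrite -[X in measurable X]setTI; exact: cdf_measurable.
have I0 : (\int[mu]_(x in F @^-1` B) `|(EFin \o fp) x| = 0)%E.
  under eq_integral do rewrite /= ger0_norm ?pospart_ge0//.
  rewrite law_cdf_set//.
  apply: (subset_measure0 _ mN _ N0); first exact: measurableI.
  by move=> z [[]].
have : ae_eq mu (F @^-1` B) (EFin \o fp) (cst 0%E).
  by apply/ae_eq_integral_abs.
apply: filterS => x fx0 fx.
have nB : ~ B (F x).
  move=> /fx0 /=; rewrite /pospart max_l ?ltW// => -[fx0'].
  by rewrite fx0' ltxx in fx.
have Fx01 : `]0%R, 1%R[%classic (F x).
  by apply: contrapT => h; apply: nB; left.
split => //; apply: contrapT => h; apply: nB; right; apply: PN => /=.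
by move=> /(_ Fx01).
Qed.

Lemma measurable_comp_cdf d (T : measurableType d) (g : R -> T) :
  measurable_fun (`]0%R, 1%R[%classic : set R) g ->
  measurable_fun (setT : set R) (fun x => g (F x)).
Proof.
move=> mg.
have m01 := measurable_fun_cc01 mg.
apply: (@measurable_comp _ _ _ R R T _ g setT F _ _ m01 cdf_measurable) => //.
by move=> _ [x _ <-] /=; rewrite in_itv/= cdf_ge0 cdf_le1.
Qed.

Lemma supp_pospart x : fp x != 0 -> supp f x.
Proof.
by rewrite /supp/= /pospart; case: leP; rewrite ?eqxx// => + _.
Qed.

Lemma measurable_supp : measurable (supp f).
Proof.
rewrite -[X in measurable X]setTI.
have -> : supp f = f @^-1` `]0, +oo[.
  by apply/seteqP; split => x; rewrite /supp/= in_itv/= andbT.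
exact: mf.
Qed.

(** Here [phi] is constrained on (0, 1) only: [f] vanishes almost everywhere
    where [F] is 0 or 1. *)
Lemma law_cdf (D : set R) (phi : R -> \bar R) : measurable D -> supp f `<=` D ->
  measurable_fun (`]0%R, 1%R[%classic : set R) phi ->
  (forall z, `]0%R, 1%R[%classic z -> 0 <= phi z)%E ->
  (\int[mu]_(x in D) (phi (F x) * (fp x)%:E) = \int[mu]_(z in `]0%R, 1%R[) phi z)%E.
Proof.
move=> mD fD mphi phi0.
pose psi := (phi \_ `]0%R, 1%R[)%E.
have mpsi : measurable_fun setT psi by exact/(measurable_restrictT _ _).1.
have psi0 z : (0 <= psi z)%E by exact: erestrict_ge0.
rewrite [RHS]integral_mkcond -/psi.
have psiE : psi = psi \_ `]0%R, 1%R[.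
  by apply/funext => x; rewrite /psi !patchE; case: ifP.
rewrite psiE -integral_mkcond -law_cdfT//.
rewrite integral_mkcond; apply: ae_eq_integral => //.
- apply/(measurable_restrictT _ mD); apply: measurable_funTS.
  apply: emeasurable_funM => //; exact: measurable_comp_cdf.
- apply: emeasurable_funM => //.
  by apply: measurableT_comp => //; exact: cdf_measurable.
- have : {ae mu, forall z, `]0%R, 1%R[%classic z -> True} by exact: aeW.
  move=> /ae_cdf; apply: filterS => x h _.
  rewrite patchE; have [fx0|] := eqVneq (fp x) 0; first by rewrite fx0 !mule0 if_same.
  move=> /supp_pospart sx; rewrite mem_set; last exact: fD.
  by have [Fx _] := h sx; rewrite /psi patchE mem_set.
Qed.

End density.
End density_basics.

(** * The operator [Uop f] is an isometry *)

Section complex_parts.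
Context {R : realType}.
Implicit Types (z : R[i]) (r : R) (g : R -> R[i]).
Local Open Scope complex_scope.
Local Open Scope ring_scope.

Lemma abs2E z : abs2 z = complex.Re z ^+ 2 + complex.Im z ^+ 2.
Proof. by case: z => a b; rewrite /abs2/= sqr_sqrtr// addr_ge0// sqr_ge0. Qed.

Lemma abs2_ge0 z : 0 <= abs2 z.
Proof. by rewrite abs2E addr_ge0// sqr_ge0. Qed.

Lemma ReMr z r : complex.Re (z * r%:C) = complex.Re z * r.
Proof. by case: z => a b /=; rewrite mulr0 subr0. Qed.

Lemma ImMr z r : complex.Im (z * r%:C) = complex.Im z * r.
Proof. by case: z => a b /=; rewrite mulr0 add0r. Qed.

Lemma abs2Mr z r : abs2 (z * r%:C) = abs2 z * r ^+ 2.
Proof. by rewrite !abs2E ReMr ImMr !exprMn mulrDl. Qed.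

Lemma measurable_abs2 (A : set R) g : cmeasurable A g ->
  measurable_fun A (fun x => abs2 (g x)).
Proof.
move=> [mr mi].
rewrite (_ : (fun _ => _) =
  (fun x => complex.Re (g x) ^+ 2 + complex.Im (g x) ^+ 2)).
  by apply: measurable_funD; apply: measurable_funX.
by apply/funext => x; rewrite abs2E.
Qed.

End complex_parts.

Section Uop_isometry.
Context {R : realType}.
Local Notation mu := (@lebesgue_measure R).
Variables (f : R -> R) (hf : is_density f).
Local Notation fp := (pospart f).
Local Notation F := (cdf_of f).
Local Notation U01 := (`]0%R, 1%R[%classic : set R).
Local Open Scope complex_scope.
Local Open Scope ring_scope.

Let mf := density_measurable hf.

Lemma measurable_sqrt_density : measurable_fun setT (fun x => Num.sqrt (f x)).
Proof.
apply: (@measurableT_comp _ _ _ R R R (@Num.sqrt R) _ f) => //.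
by apply: continuous_measurable_fun; exact: sqrt_continuous.
Qed.

Lemma cmeasurable_Uop (D : set R) g : cmeasurable U01 g ->
  cmeasurable D (Uop f g).
Proof.
move=> [mr mi].
have ms := measurable_sqrt_density.
split; apply: measurable_funTS.
- rewrite (_ : (fun _ => _) = (fun x => complex.Re (g (F x)) * Num.sqrt (f x))).
    by apply: measurable_funM => //; exact: (measurable_comp_cdf hf mr).
  by apply/funext => x; rewrite /Uop ReMr.
- rewrite (_ : (fun _ => _) = (fun x => complex.Im (g (F x)) * Num.sqrt (f x))).
    by apply: measurable_funM => //; exact: (measurable_comp_cdf hf mi).
  by apply/funext => x; rewrite /Uop ImMr.
Qed.

Lemma abs2_Uop g x : abs2 (Uop f g x) = abs2 (g (F x)) * fp x.
Proof. by rewrite /Uop abs2Mr sqr_sqrt_pospart. Qed.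

(** The target [D] is the whole line in the isometry statement, and [supp f] for
    unitarity and for the basis. *)
Variables (D : set R) (mD : measurable D) (fD : supp f `<=` D).

Lemma integral_abs2_Uop g : cmeasurable U01 g ->
  (\int[mu]_(x in D) (abs2 (Uop f g x))%:E = \int[mu]_(z in U01) (abs2 (g z))%:E)%E.
Proof.
move=> mg; rewrite -(law_cdf hf mD fD).
- by apply: eq_integral => x _; rewrite abs2_Uop EFinM.
- by apply/measurable_EFinP; exact: measurable_abs2.
- by move=> z _; rewrite lee_fin abs2_ge0.
Qed.

Lemma L2_Uop g : L2 U01 g -> L2 D (Uop f g).
Proof.
move=> [mg goo]; split; first exact: cmeasurable_Uop.
by rewrite integral_abs2_Uop.
Qed.

Lemma L2norm_Uop g : L2 U01 g -> L2norm D (Uop f g) = L2norm U01 g.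
Proof. by move=> [mg _]; rewrite /L2norm /Rintegral integral_abs2_Uop. Qed.

Lemma ae_eq_Uop g h : ae_eq mu U01 g h -> ae_eq mu D (Uop f g) (Uop f h).
Proof.
move=> /(ae_cdf hf); apply: filterS => x gh _; rewrite /Uop.
have [fx|fx] := leP (f x) 0; first by rewrite ler0_sqrtr// !mulr0.
by have [_ ->] := gh fx.
Qed.

Lemma Uop_linear : L2_linear U01 D (Uop f).
Proof.
split; [exact: L2_Uop|by move=> g h _ _; exact: ae_eq_Uop|].
by move=> a g h _ _; apply: aeW => x _; rewrite /Uop mulrDl mulrA.
Qed.

Lemma Uop_isometry : L2_isometry U01 D (Uop f).
Proof. by split; [exact: Uop_linear|exact: L2norm_Uop]. Qed.

(** Splitting into positive and negative parts makes this valid for every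
    measurable [G], integrable or not. *)
Lemma Rintegral_cdf (G : R -> R) : measurable_fun U01 G ->
  (\int[mu]_(x in D) (G (F x) * fp x) = \int[mu]_(z in U01) G z)%R.
Proof.
move=> mG; rewrite /Rintegral; congr fine.
have mG' : measurable_fun U01 (EFin \o G) by exact/measurable_EFinP.
rewrite integralE [RHS]integralE; congr (_ - _)%E.
- rewrite -(law_cdf hf mD fD); last 2 first.
    exact: measurable_funepos.
    by move=> z _; exact: funepos_ge0.
  apply: eq_integral => x _; rewrite !funeposE -!EFin_max -EFinM.
  by rewrite maxr_pMl ?pospart_ge0// mul0r.
- rewrite -(law_cdf hf mD fD); last 2 first.
    exact: measurable_funeneg.
    by move=> z _; exact: funeneg_ge0.
  apply: eq_integral => x _; rewrite !funenegE -!EFinN -!EFin_max -EFinM.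
  by rewrite maxr_pMl ?pospart_ge0// mul0r mulNr.
Qed.

Lemma L2inner_Uop g h : cmeasurable U01 g -> cmeasurable U01 h ->
  L2inner D (Uop f g) (Uop f h) = L2inner U01 g h.
Proof.
move=> [mgr mgi] [mhr mhi].
have E x : Uop f g x * (Uop f h x)^* = (g (F x) * (h (F x))^*) * (fp x)%:C.
  rewrite /Uop -sqr_sqrt_pospart rmorphM/=.
  have -> : ((Num.sqrt (f x))%:C)^* = (Num.sqrt (f x))%:C.
    by apply/eqP; rewrite eq_complex/= oppr0 !eqxx.
  by rewrite rmorphXn/= expr2; ring.
have mprod (P : R[i] -> R) : P = complex.Re (R := R) \/ P = complex.Im (R := R) ->
    measurable_fun U01 (fun z => P (g z * (h z)^*)).
  case=> ->.
  - rewrite (_ : (fun _ => _) = (fun z => complex.Re (g z) * complex.Re (h z) +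
        complex.Im (g z) * complex.Im (h z))).
      by apply: measurable_funD; apply: measurable_funM.
    by apply/funext => z; case: (g z) (h z) => [a b] [c d] /=; ring.
  - rewrite (_ : (fun _ => _) = (fun z => complex.Im (g z) * complex.Re (h z) -
        complex.Re (g z) * complex.Im (h z))).
      by apply: measurable_funB; apply: measurable_funM.
    by apply/funext => z; case: (g z) (h z) => [a b] [c d] /=; ring.
rewrite /L2inner /cintegral; congr (_ +i* _).
- rewrite -Rintegral_cdf; last by apply: mprod; left.
  by apply: eq_Rintegral => x _; rewrite E ReMr.
- rewrite -Rintegral_cdf; last by apply: mprod; right.
  by apply: eq_Rintegral => x _; rewrite E ImMr.
Qed.

End Uop_isometry.

(** * Positive continuous densities: inverting [Uop f] *)

Section quantile.
Context {R : realType}.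
Local Notation mu := (@lebesgue_measure R).
Variables (f : R -> R) (pf : pos_density f).
Local Notation fp := (pospart f).
Local Notation F := (cdf_of f).
Local Notation Q := (quantile_of f).
Local Notation U01 := (`]0%R, 1%R[%classic : set R).
Local Open Scope complex_scope.
Local Open Scope ring_scope.

Let hf : is_density f. Proof. by case: pf. Qed.

Lemma pos_density_pospart : fp = f.
Proof.
apply/funext => x; case: pf => _ [I [_ _ fI fnI]]; rewrite /pospart.
by apply: max_l; have [/fI/ltW//|/fnI ->] := pselect (I x).
Qed.

Lemma pos_density_suppP : [/\ open (supp f), is_interval (supp f) &
  {in supp f, continuous f}].
Proof.
case: pf => _ [I [[oI iI] cI fI fnI]].
have -> : supp f = I.
  apply/seteqP; split => x; rewrite /supp/=; last exact: fI.
  by move=> fx; apply: contrapT => /fnI fx0; rewrite fx0 ltxx in fx.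
by split=> //; rewrite continuous_open_subspace// in cI.
Qed.

Lemma cdf_derive x : supp f x -> is_derive x 1 F (f x).
Proof.
have [_ _ cf] := pos_density_suppP; move=> sx.
have FE : F = fun x => (\int[mu]_(t in [set` Interval -oo%O (BRight x)]) f t)%R.
  by [].
have [] := @continuous_FTC1 R f -oo%O x (x + 1) _ _ _ (cf x (mem_set sx)).
- by rewrite ltrDl.
- by rewrite -pos_density_pospart; exact: integrable_pospart.
- by rewrite ltNyr.
rewrite -FE derive1E => dF <-; exact: DeriveDef.
Qed.

Lemma cdf_lt x y : supp f x -> supp f y -> x < y -> F x < F y.
Proof.
have [_ iI _] := pos_density_suppP; move=> sx sy xy.
have sub c : c \in `]x, y[ -> supp f c.
  by rewrite in_itv/= => /andP[xc cy]; apply: (iI x y) => //; rewrite !ltW.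
have [||c /sub fc FE] := @MVT R F f x y xy.
- by move=> c /sub; exact: cdf_derive.
- by apply: continuous_subspaceT; exact: cdf_continuous.
by rewrite -subr_gt0 FE mulr_gt0// subr_gt0.
Qed.

Lemma cdf_supp01 x : supp f x -> U01 (F x).
Proof.
have [oI _ _] := pos_density_suppP; move=> sx.
have [e /= e0 se] : nbhs_ball x (supp f) by apply/nbhs_ballP; exact: open_nbhs_nbhs.
have sl : supp f (x - e / 2).
  by apply: se; rewrite /ball/= opprB addrC subrK gtr0_norm; lra.
have sr : supp f (x + e / 2).
  by apply: se; rewrite /ball/= opprD addNKr normrN gtr0_norm; lra.
rewrite /= in_itv/=; apply/andP; split.
  apply: le_lt_trans (cdf_ge0 hf (x - e / 2)) _; apply: cdf_lt => //; lra.
apply: lt_le_trans (cdf_le1 hf (x + e / 2)); apply: cdf_lt => //; lra.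
Qed.

Lemma cdf_inj : {in supp f &, injective F}.
Proof.
move=> x y; rewrite !inE => sx sy Fxy; apply/eqP; rewrite eq_le !leNgt.
apply/andP; split; apply/negP => xy.
  by have := cdf_lt sy sx xy; rewrite Fxy ltxx.
by have := cdf_lt sx sy xy; rewrite Fxy ltxx.
Qed.

(** If a solution [b] of [F b = z] were outside the support, which is an interval,
    then all the mass would lie on one side of [b], and [z] would be 0 or 1. *)
Lemma cdf_supp_surj z : U01 z -> exists2 x, supp f x & F x = z.
Proof.
have [_ iI _] := pos_density_suppP.
rewrite /= in_itv/= => /andP[z0 z1].
have [|b Fb] := cdf_attained hf (z := z); first by rewrite z0 z1.
exists b => //; apply: contrapT => nb.
have [left0|right0] : (forall x, x <= b -> fp x = 0) \/ (forall x, b < x -> fp x = 0).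
  have [[a ab sa]|h] := pselect (exists2 a, a <= b & supp f a).
    right=> x bx; apply: contrapT => /eqP /supp_pospart sx; apply: nb.
    by apply: (iI a x) => //; rewrite ab ltW.
  left=> x xb; apply: contrapT => /eqP /supp_pospart sx; apply: h.
  by exists x.
- have : (F b)%:E = 0%E.
    rewrite (EFin_cdf hf); apply: integral0_eq => x.
    by rewrite /= in_itv/= => xb; rewrite left0.
  by move=> [Fb0]; rewrite -Fb Fb0 ltxx in z0.
- have : (1 - F b)%:E = 0%E.
    rewrite -(integral_pospart_ray hf); apply: integral0_eq => x.
    by rewrite /= in_itv/= andbT => xb; rewrite right0.
  by move=> [/eqP]; rewrite Fb subr_eq0 => /eqP z1'; rewrite z1' ltxx in z1.
Qed.

Lemma cdfK x : supp f x -> Q (F x) = x.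
Proof. by move=> sx; apply: pinvKV; [exact: cdf_inj|rewrite inE]. Qed.

Lemma quantileK z : U01 z -> supp f (Q z) /\ F (Q z) = z.
Proof. by move=> /cdf_supp_surj[x sx <-]; rewrite cdfK. Qed.

Lemma quantile_derive x : supp f x -> is_derive (F x) 1 Q (f x)^-1.
Proof.
have [oI _ _] := pos_density_suppP; move=> sx.
apply: is_derive_inverse.
- have : \forall y \near x, supp f y by exact: open_nbhs_nbhs.
  by apply: filterS => y; exact: cdfK.
- by near=> y; exact: (cdf_continuous hf).
- exact: cdf_derive.
- by rewrite gt_eqF.
Unshelve. all: by end_near. Qed.

Lemma derive1_quantile z : U01 z -> derive1 Q z = (f (Q z))^-1.
Proof.
move=> /quantileK[sQ Fz]; rewrite -[in LHS]Fz derive1E.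
by have := quantile_derive sQ; case.
Qed.

Lemma measurable_quantile : measurable_fun U01 Q.
Proof.
apply: open_continuous_measurable_fun; first exact: interval_open.
move=> z; rewrite inE => /quantileK[sQ Fz].
have [dQ _] := quantile_derive sQ; rewrite Fz in dQ.
by apply: differentiable_continuous; exact/derivable1_diffP.
Qed.

Lemma measurable_comp_quantile (k : R -> R) : measurable_fun (supp f) k ->
  measurable_fun U01 (fun z => k (Q z)).
Proof.
move=> mk.
apply: (@measurable_comp _ _ _ R R R _ k U01 Q _ _ mk measurable_quantile).
  exact: (measurable_supp hf).
by move=> _ [z /quantileK[sQ _] <-].
Qed.

Lemma UinvE psi z : U01 z ->
  Uinv f psi z = psi (Q z) * (Num.sqrt (f (Q z))^-1)%:C.
Proof. by move=> z01; rewrite /Uinv derive1_quantile. Qed.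

Lemma cmeasurable_Uinv psi : cmeasurable (supp f) psi -> cmeasurable U01 (Uinv f psi).
Proof.
move=> [mr mi].
have ms : measurable_fun U01 (fun z => Num.sqrt (f (Q z))^-1).
  apply: (measurable_comp_quantile (k := fun x => Num.sqrt (f x)^-1)).
  have [oI _ cf] := pos_density_suppP.
  apply: open_continuous_measurable_fun => // x xI.
  apply: continuous_comp; last exact: sqrt_continuous.
  apply: continuousV; last exact: cf.
  by move: xI; rewrite inE => fx; rewrite gt_eqF.
split.
- apply: (eq_measurable_fun (fun z => complex.Re (psi (Q z)) * Num.sqrt (f (Q z))^-1)).
    by move=> z; rewrite inE => z01; rewrite UinvE// ReMr.
  by apply: measurable_funM => //; exact: (measurable_comp_quantile mr).
- apply: (eq_measurable_fun (fun z => complex.Im (psi (Q z)) * Num.sqrt (f (Q z))^-1)).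
    by move=> z; rewrite inE => z01; rewrite UinvE// ImMr.
  by apply: measurable_funM => //; exact: (measurable_comp_quantile mi).
Qed.

Lemma Uinv_cdf psi x : supp f x ->
  Uinv f psi (F x) = psi x * (Num.sqrt (f x)^-1)%:C.
Proof. by move=> sx; rewrite UinvE ?cdfK//; exact: cdf_supp01. Qed.

Lemma UopK psi x : supp f x -> Uop f (Uinv f psi) x = psi x.
Proof.
move=> sx; rewrite /Uop Uinv_cdf// -mulrA -rmorphM/= -sqrtrM; last first.
  by rewrite invr_ge0 ltW.
by rewrite mulVf ?sqrtr1 ?mulr1// gt_eqF.
Qed.

Lemma UinvK g z : U01 z -> Uinv f (Uop f g) z = g z.
Proof.
move=> z01; have [sQ Fz] := quantileK z01.
rewrite UinvE// /Uop Fz -mulrA -rmorphM/= -sqrtrM ?ltW//.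
by rewrite mulfV ?sqrtr1 ?mulr1// gt_eqF.
Qed.

(** [Uop f] takes [Uinv f psi] back to [psi] on the support and preserves the
    integral of the squared modulus. *)
Lemma L2_Uinv psi : L2 (supp f) psi -> L2 U01 (Uinv f psi).
Proof.
move=> [mpsi psioo]; have mU := cmeasurable_Uinv mpsi.
split=> //; rewrite -(integral_abs2_Uop hf (measurable_supp hf) _ mU)//.
apply: le_lt_trans psioo; rewrite le_eqVlt; apply/orP; left; apply/eqP.
by apply: eq_integral => x; rewrite inE => sx; rewrite UopK.
Qed.

(** On the support, [F] pulls [Q^-1(N)] back into [N], so the law of [F] makes
    [Q^-1(N)] null when [N] is. *)
Lemma ae_eq_Uinv psi psi' : ae_eq mu (supp f) psi psi' ->
  ae_eq mu U01 (Uinv f psi) (Uinv f psi').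
Proof.
move=> [N [mN N0 sN]].
have mQ : measurable (U01 `&` Q @^-1` N).
  by apply: measurable_quantile => //.
exists (U01 `&` Q @^-1` N); split => //.
- have <- : (U01 `&` Q @^-1` N) `&` U01 = U01 `&` Q @^-1` N.
    by rewrite setIAC setIid.
  apply: (etrans (esym (law_cdf_set hf mQ))).
  have mFQ : measurable (F @^-1` (U01 `&` Q @^-1` N)).
    rewrite -[X in measurable X]setTI; exact: (cdf_measurable hf).
  rewrite (ge0_negligible_integral mN)//.
  + apply: integral0_eq => x [[_ /= QN] xN].
    rewrite [fp x](_ : _ = 0)//; apply: contrapT => /eqP /supp_pospart sx.
    by apply: xN; rewrite cdfK in QN.
  + apply: measurable_funTS; apply/measurable_EFinP.
    exact: (measurable_pospart (density_measurable hf)).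
  + by move=> x _; rewrite lee_fin pospart_ge0.
- move=> z /= /not_implyP[z01 h]; split => //=; apply: sN => /=.
  by have [sQ _] := quantileK z01; move=> /(_ sQ) e; apply: h; rewrite /Uinv e.
Qed.

Lemma Uinv_linear : L2_linear (supp f) U01 (Uinv f).
Proof.
split; [exact: L2_Uinv|by move=> g h _ _; exact: ae_eq_Uinv|].
by move=> a g h _ _; apply: aeW => x _; rewrite /Uinv mulrDl mulrA.
Qed.

Lemma Uop_unitary : L2_unitary U01 (supp f) (Uop f).
Proof.
split.
- exact: (Uop_linear hf (measurable_supp hf)).
- by move=> g h [mg _] [mh _]; exact: (L2inner_Uop hf (measurable_supp hf)).
- move=> psi /L2_Uinv L2psi; exists (Uinv f psi) => //.
  by apply: aeW => x sx; rewrite UopK.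
Qed.

Lemma Uop_inverse : L2_inverse U01 (supp f) (Uop f) (Uinv f).
Proof.
split; first exact: Uinv_linear.
- by move=> g _; apply: aeW => z z01; rewrite UinvK.
- by move=> psi _; apply: aeW => x sx; rewrite UopK.
Qed.

End quantile.

(** * Closed subspaces of real [L^2] *)

Lemma measurable_invr (R : realType) : measurable_fun setT (@GRing.inv R).
Proof.
have o0 : open (~` [set (0 : R)]) by apply: closed_openC; exact: closed_eq.
have -> : @GRing.inv R = (fun y : R => y^-1) \_ (~` [set (0 : R)]).
  apply/funext => x; rewrite patchE; case: ifPn => //.
  by rewrite notin_setE/= => /contrapT ->; rewrite invr0.
apply/(measurable_restrictT _ _).1; first exact: open_measurable.
apply: open_continuous_measurable_fun => // x; rewrite inE/= => /eqP x0.
exact: inv_continuous.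
Qed.

Section L2_closure.
Context {R : realType}.
Local Notation mu := (@lebesgue_measure R).
Implicit Types (r q s u M : R -> R).

Definition sqint r : \bar R := (\int[mu]_x ((r x) ^+ 2)%:E)%E.

Let sqE0 r x : (0 <= ((r x) ^+ 2)%:E)%E. Proof. by rewrite lee_fin sqr_ge0. Qed.
#[local] Hint Resolve sqE0 : core.

Lemma measurable_sqE (r : R -> R) : measurable_fun setT r ->
  measurable_fun setT (fun x => ((r x) ^+ 2)%:E).
Proof. by move=> mr; apply/measurable_EFinP; apply: measurable_funX. Qed.

(** The form in which the triangle inequality is used: a pointwise bound on
    squares, for instance [(x + y)^2 <= 2 x^2 + 2 y^2], is integrated. *)
Lemma sqint_comb (a b : R) r q s :
  measurable_fun setT r -> measurable_fun setT q -> measurable_fun setT s ->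
  (forall x, (s x) ^+ 2 <= a * (r x) ^+ 2 + b * (q x) ^+ 2) -> 0 <= a -> 0 <= b ->
  (sqint s <= a%:E * sqint r + b%:E * sqint q)%E.
Proof.
move=> mr mq ms le a0 b0.
have m2r := measurable_sqE mr; have m2q := measurable_sqE mq.
rewrite /sqint -!ge0_integralZl//.
rewrite -ge0_integralD//; last 4 first.
- by move=> x _; rewrite mule_ge0// lee_fin.
- exact: measurable_funeM.
- by move=> x _; rewrite mule_ge0// lee_fin.
- exact: measurable_funeM.
apply: ge0_le_integral => //.
- exact: measurable_sqE.
- by apply: emeasurable_funD; exact: measurable_funeM.
- by move=> x _; rewrite -!EFinM -EFinD lee_fin.
Qed.

Variable S : (R -> R) -> Prop.
Hypothesis mS : forall r, S r -> measurable_fun setT r.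
Hypothesis SD : forall r q, S r -> S q -> S (fun x => r x + q x).
Hypothesis SZ : forall (a : R) r, S r -> S (fun x => a * r x).

(** The [L^2] closure of [S], as a set of functions and not of classes. *)
Definition L2_adherent r := measurable_fun setT r /\
  forall eps : R, 0 < eps ->
    exists2 q, S q & (sqint (fun x => (r x - q x)%R) < eps%:E)%E.
Local Notation V := L2_adherent.

Lemma adherent_sub r : S r -> V r.
Proof.
move=> Sr; split=> [|eps e0]; first exact: mS.
exists r => //; rewrite /sqint.
rewrite [X in (X < _)%E](_ : _ = 0%E) ?lte_fin//.
by apply: integral0_eq => x _; rewrite subrr expr0n.
Qed.

Lemma adherentD r q : V r -> V q -> V (fun x => r x + q x).
Proof.
move=> [mr Vr] [mq Vq]; split=> [|eps e0]; first exact: measurable_funD.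
have e4 : 0 < eps / 4 by rewrite divr_gt0.
have [r' Sr' hr] := Vr _ e4; have [q' Sq' hq] := Vq _ e4.
exists (fun x => r' x + q' x); first exact: SD.
have mr' := mS Sr'; have mq' := mS Sq'.
apply: (@le_lt_trans _ _ (2%:E * sqint (fun x => (r x - r' x)%R) +
    2%:E * sqint (fun x => (q x - q' x)%R))%E).
  apply: sqint_comb => //.
  - exact: measurable_funB.
  - exact: measurable_funB.
  - by apply: measurable_funB; apply: measurable_funD.
  - move=> x; rewrite -subr_ge0.
    rewrite (_ : _ - _ = ((r x - r' x) - (q x - q' x)) ^+ 2) ?sqr_ge0//; ring.
have -> : eps = 2 * (eps / 4) + 2 * (eps / 4) by lra.
by rewrite [ltRHS]EFinD; apply: lteD; rewrite [ltRHS]EFinM lte_pmul2l.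
Qed.

Lemma adherentZ (a : R) r : V r -> V (fun x => a * r x).
Proof.
move=> [mr Vr]; split=> [|eps e0]; first exact: measurable_funM.
have a2 : 0 < a ^+ 2 + 1 by rewrite ltr_wpDl ?sqr_ge0.
have [r' Sr' hr] := Vr _ (divr_gt0 e0 a2).
exists (fun x => a * r' x); first exact: SZ.
have mr' := mS Sr'.
apply: (@le_lt_trans _ _ ((a ^+ 2 + 1)%:E * sqint (fun x => (r x - r' x)%R) +
    0%:E * sqint (fun x => (r x - r' x)%R))%E).
  apply: sqint_comb => //.
  - exact: measurable_funB.
  - exact: measurable_funB.
  - by apply: measurable_funB; apply: measurable_funM.
  - move=> x; rewrite -subr_ge0.
    rewrite (_ : _ - _ = (r x - r' x) ^+ 2) ?sqr_ge0//; ring.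
  - exact: ltW.
rewrite mul0e adde0.
have -> : eps = (a ^+ 2 + 1) * (eps / (a ^+ 2 + 1)).
  by rewrite mulrC divfK// gt_eqF.
by rewrite [ltRHS]EFinM lte_pmul2l.
Qed.

Lemma adherent_dominated (rn : nat -> R -> R) r M :
  (forall n, V (rn n)) -> measurable_fun setT r ->
  measurable_fun setT M -> (sqint M < +oo)%E ->
  {ae mu, forall x, rn n x @[n --> \oo] --> r x} ->
  (forall n x, `|rn n x| <= M x) -> (forall x, `|r x| <= M x) -> V r.
Proof.
move=> Vn mr mM Moo cvn leM lerM; split=> // eps e0.
have m4 n : measurable_fun setT (fun x => r x - rn n x).
  by apply: measurable_funB => //; have [] := Vn n.
have iM : mu.-integrable setT (fun x => (4 * (M x) ^+ 2)%:E).
  under [X in integrable _ _ X]eq_fun do rewrite EFinM.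
  apply: integrableZl => //; apply/integrableP; split; first exact: measurable_sqE.
  by under eq_integral do rewrite gee0_abs//.
have [||||| _ _] := @dominated_convergence _ (measurableTypeR R) R mu setT measurableT
  (fun n x => ((r x - rn n x) ^+ 2)%:E) (cst 0%E) (fun x => (4 * (M x) ^+ 2)%:E).
- by move=> n; exact: measurable_sqE.
- exact: measurable_cst.
- move: cvn; apply: filterS => x cvx _ /=.
  apply: cvg_EFin; first by apply: nearW.
  rewrite [X in _ --> X](_ : _ = (r x - r x) ^+ 2); last by rewrite subrr expr0n.
  rewrite /comp/=; apply: (@cvg_comp _ _ _ _ (fun y : R => y ^+ 2)); last exact: exprn_continuous.
  by apply: cvgB => //; exact: cvg_cst.
- exact: iM.
- apply: aeW => x n _; rewrite gee0_abs// lee_fin.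
  have h : `|r x - rn n x| <= 2 * M x.
    rewrite (le_trans (ler_normB _ _))// mulr2n mulrDl !mul1r lerD//.
  rewrite -real_normK ?num_real// (_ : 4 * _ = (2 * M x) ^+ 2); last by ring.
  by rewrite lerXn2r// nnegrE ?(le_trans _ h).
rewrite integral0_eq// => cv0.
have e4 : (0 < (eps / 4)%:E)%E by rewrite lte_fin divr_gt0.
have [N _ hN] : \forall n \near \oo,
    (\int[mu]_x ((r x - rn n x) ^+ 2)%:E < (eps / 4)%:E)%E.
  have : nbhs (0%E : \bar R) [set y : \bar R | (y < (eps / 4)%:E)%E].
    by apply: open_nbhs_nbhs; split => //; exact: open_ereal_lt_ereal.
  by move=> /cv0.
have {}hN := hN _ (leqnn N).
have [mrN /(_ (eps / 4))[|q Sq hq]] := Vn N; first by rewrite divr_gt0.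
exists q => //; have mq := mS Sq.
apply: (@le_lt_trans _ _ (2%:E * sqint (fun x => (r x - rn N x)%R) +
    2%:E * sqint (fun x => (rn N x - q x)%R))%E).
  apply: sqint_comb => //.
  - exact: measurable_funB.
  - exact: measurable_funB.
  - move=> x; rewrite -subr_ge0.
    rewrite (_ : _ - _ = ((r x - rn N x) - (rn N x - q x)) ^+ 2) ?sqr_ge0//; ring.
have -> : eps = 2 * (eps / 4) + 2 * (eps / 4) by lra.
by rewrite [ltRHS]EFinD; apply: lteD; rewrite [ltRHS]EFinM lte_pmul2l.
Qed.

Lemma adherent_ae r q : V r -> measurable_fun setT q -> ae_eq mu setT r q -> V q.
Proof.
move=> [mr Vr] mq rq; split=> // eps /Vr[s Ss hs]; exists s => //.
have ms := mS Ss.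
apply: le_lt_trans hs; rewrite le_eqVlt; apply/orP; left; apply/eqP.
apply: ge0_ae_eq_integral => //.
- by apply: measurable_sqE; exact: measurable_funB.
- by apply: measurable_sqE; exact: measurable_funB.
- by move: rq; apply: filterS => x /(_ Logic.I) -> _.
Qed.

Lemma adherent_sum (I : Type) (s : seq I) (g : I -> R -> R) :
  V (cst 0) -> (forall i, V (g i)) -> V (fun x => \sum_(i <- s) g i x).
Proof.
move=> V0 Vg; elim: s => [|i s IH].
  by rewrite (_ : (fun _ => _) = cst 0)//; apply/funext => x; rewrite big_nil.
rewrite (_ : (fun _ => _) = fun x => g i x + \sum_(j <- s) g j x).
  exact: adherentD.
by apply/funext => x; rewrite big_cons.
Qed.

(** From one weight [u] to the whole of [L^2] on [{u <> 0}].  If the closure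
    contains [u] and all products of [u] with indicators of rays, then it contains
    the products of [u] with indicators of Borel sets (pi-lambda theorem), with
    simple functions (linearity), and finally all square-integrable [r], as
    [r / u] is a limit of simple functions. *)
Section weight.
Variable u : R -> R.
Hypotheses (Vu : V u) (u0 : forall x, 0 <= u x) (uoo : (sqint u < +oo)%E).
Hypothesis Vray : forall a, V (fun x => u x * \1_(`]a, +oo[%classic) x).

Let mu_ : measurable_fun setT u. Proof. by case: Vu. Qed.

Let V0 : V (cst 0).
Proof.
rewrite (_ : cst 0 = fun x => 0 * u x); first exact: adherentZ.
by apply/funext => x; rewrite mul0r.
Qed.

Lemma adherent_indic (A : set R) : measurable A -> V (fun x => u x * \1_A x).
Proof.
move=> mA.
apply: (@dynkin_induction _ R (@RGenOInfty.G R) (fun A => V (fun x => u x * \1_A x))).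
- exact: RGenOInfty.measurableE.
- move=> _ _ [x ->] [y ->]; exists (Num.max x y).
  by apply/seteqP; split => z /=; rewrite !in_itv/= !andbT gt_max => /andP.
- rewrite (_ : (fun _ => _) = u)//.
  by apply/funext => x; rewrite indicT mulr1.
- by move=> _ [a ->]; exact: Vray.
- move=> B _ VB.
  rewrite (_ : (fun _ => _) = fun x => u x + -1 * (u x * \1_B x)).
    by apply: adherentD => //; exact: adherentZ.
  apply/funext => x; rewrite !indicE in_setC.
  by case: (x \in B) => /=; ring.
- move=> B mB tB VB.
  (* The sets are disjoint, so at each point at most one term is nonzero. *)
  pose rn n x := \sum_(k < n) u x * \1_(B k) x.
  have rnE n x k0 : B k0 x -> rn n x = u x * (k0 < n)%:R.
    move=> Bk; rewrite /rn.
    under eq_bigr => k _.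
      rewrite (_ : \1_(B k) x = (val k == k0)%:R); first over.
      rewrite indicE; congr (_%:R); congr nat_of_bool; apply/idP/eqP => [|->].
        rewrite inE => Bkx; have /trivIsetP := tB.
        move=> /(_ k k0 Logic.I Logic.I); case: eqVneq => // _ /(_ isT) e.
        by have : (B k `&` B k0) x by []; rewrite e.
      by rewrite inE.
    rewrite -mulr_sumr; congr (_ * _); rewrite -natr_sum; congr (_%:R).
    have [kn|kn] := ltnP k0 n.
      rewrite (bigD1 (Ordinal kn))//= eqxx big1 ?addn0// => i /negP ni.
      by case: eqP => // e; case: ni; apply/eqP/val_inj.
    by rewrite big1// => i _; case: eqP => // e; move: kn; rewrite -e leqNgt ltn_ord.
  have rn0 n x : (forall k, ~ B k x) -> rn n x = 0.
    by move=> nB; rewrite /rn big1// => k _; rewrite indicE memNset ?mulr0.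
  have rle n x : `|rn n x| <= u x.
    have [[k Bk]|/forallNP nB] := pselect (exists k, B k x); last by rewrite rn0 ?normr0.
    by rewrite (rnE _ _ _ Bk); case: (k < n)%N; rewrite ?mulr1 ?mulr0 ?normr0 ?ger0_norm.
  apply: (@adherent_dominated rn _ u) => //.
  + move=> n; rewrite /rn.
    rewrite (_ : (fun _ => _) = fun x => \sum_(k <- index_enum 'I_n) u x * \1_(B k) x)//.
    by apply: adherent_sum => // k; exact: VB.
  + apply: measurable_funM => //; apply: measurable_indic; exact: bigcupT_measurable.
  + apply: aeW => x.
    have [[k Bk]|/forallNP nB] := pselect (exists k, B k x).
      rewrite indicE mem_set ?mulr1; last by exists k.
      apply: cvg_near_cst; exists k.+1 => // n /= kn.
      by rewrite (rnE _ _ _ Bk) kn mulr1.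
    rewrite indicE memNset ?mulr0; last by move=> [k _]; exact: nB.
    by apply: cvg_near_cst; apply: nearW => n; rewrite rn0.
  + move=> x; rewrite indicE; case: (_ \in _); rewrite ?mulr1 ?mulr0 ?normr0//.
    by rewrite ger0_norm.
- exact: (eq_ind _ (fun m => m A) mA _ (@RGenOInfty.measurableE R)).
Qed.

Import HBNNSimple.

Lemma adherent_nnsfun (h : {nnsfun R >-> R}) : V (fun x => u x * h x).
Proof.
rewrite (_ : (fun _ => _) = fun x => \sum_(y <- finmap.enum_fset (fset_set (range h)))
    y * (u x * \1_(h @^-1` [set y]) x)).
  by apply: adherent_sum => // y; apply: adherentZ; exact: adherent_indic.
apply/funext => x; rewrite fimfunE fsbig_finite//= mulr_sumr.
by apply: eq_bigr => y _; ring.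
Qed.

Lemma adherent_ge0 r : measurable_fun setT r -> (forall x, 0 <= r x) ->
  (sqint r < +oo)%E -> (forall x, u x = 0 -> r x = 0) -> V r.
Proof.
move=> mr r0 roo ur0.
pose k x := r x / u x.
have mk : measurable_fun setT (EFin \o k).
  apply/measurable_EFinP; apply: measurable_funM => //.
  exact: (measurableT_comp (@measurable_invr R)).
have k0 x : (0 <= (EFin \o k) x)%E by rewrite lee_fin divr_ge0.
pose h := nnsfun_approx measurableT mk.
have hk x : h n x @[n --> \oo] --> k x.
  have := @cvg_nnsfun_approx _ _ _ _ measurableT _ mk (fun x _ => k0 x) x Logic.I.
  by move/fine_cvg.
have ukr x : u x * k x = r x.
  rewrite /k; have [ux|ux] := eqVneq (u x) 0; first by rewrite ux mul0r ur0.
  by rewrite mulrC divfK.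
have hlek n x : h n x <= k x.
  rewrite -(cvg_lim _ (hk x))//; apply: nondecreasing_cvgn_le; last exact: cvgP (hk x).
  by move=> a b ab; exact/lefP/nd_nnsfun_approx.
apply: (@adherent_dominated (fun n x => u x * h n x) r r) => //.
- by move=> n; exact: adherent_nnsfun.
- apply: aeW => x; rewrite -[in X in _ --> X]ukr.
  by apply: cvgM; [exact: cvg_cst|exact: hk].
- move=> n x; rewrite ger0_norm; last by rewrite mulr_ge0.
  by rewrite -[leRHS]ukr ler_wpM2l.
- by move=> x; rewrite ger0_norm.
Qed.

Lemma adherent_full r : measurable_fun setT r -> (sqint r < +oo)%E ->
  {ae mu, forall x, u x = 0 -> r x = 0} -> V r.
Proof.
move=> mr roo ur0.
pose r1 x := if u x == 0 then 0 else r x.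
have mZ : measurable [set x | u x = 0].
  by have := mu_ measurableT (measurable_set1 0); rewrite setTI.
have mr1 : measurable_fun setT r1.
  rewrite (_ : r1 = r \_ (~` [set x | u x = 0])).
    apply/(measurable_restrictT _ _).1; first exact: measurableC.
    exact: measurable_funTS.
  apply/funext => x; rewrite /r1 patchE in_setC.
  have [ux|ux] := eqVneq (u x) 0; first by rewrite mem_set.
  by rewrite memNset//; apply/eqP.
apply: (@adherent_ae r1) => //; last first.
  by move: ur0; apply: filterS => x h _; rewrite /r1; case: eqP => // /h.
have sub (s : R -> R) : measurable_fun setT s -> (forall x, `|s x| <= `|r x|) -> (sqint s < +oo)%E.
  move=> ms le; apply: le_lt_trans roo; apply: ge0_le_integral => //.
  - exact: measurable_sqE.
  - exact: measurable_sqE.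
  - by move=> x _; rewrite lee_fin -[leLHS]real_normK ?num_real//
      -[leRHS]real_normK ?num_real// lerXn2r.
rewrite (_ : r1 = fun x => Num.max (r1 x) 0 + -1 * Num.max (- r1 x) 0); last first.
  by apply/funext => x; case: (ltP (r1 x) 0); case: (ltP (- r1 x) 0) => *; lra.
apply: adherentD; last apply: adherentZ.
- apply: adherent_ge0.
  + exact: measurable_maxr.
  + by move=> x; rewrite le_max lexx orbT.
  + apply: sub; first exact: measurable_maxr.
    move=> x; rewrite /r1; case: ifP => _; first by rewrite maxxx normr0.
    by rewrite /Order.max; case: ifP => _ //; rewrite normr0.
  + by move=> x ux; rewrite /r1 ux eqxx maxxx.
- have mN : measurable_fun setT (fun x => Num.max (- r1 x) 0).
    by apply: measurable_maxr => //; exact: measurable_funN.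
  apply: adherent_ge0 => //.
  + by move=> x; rewrite le_max lexx orbT.
  + apply: sub => // x.
    rewrite /r1; case: ifP => _; first by rewrite oppr0 maxxx normr0.
    by rewrite /Order.max; case: ifP => _; rewrite ?normr0 ?normrN.
  + by move=> x ux; rewrite /r1 ux eqxx oppr0 maxxx.
Qed.

End weight.
End L2_closure.

(** * The sine functions on (0, 1) *)

Section sines.
Context {R : realType}.
Local Notation mu := (@lebesgue_measure R).
Local Notation U01 := (`]0%R, 1%R[%classic : set R).

Lemma integral01_FTC (h H : R -> R) : continuous h ->
  (forall z : R, is_derive z (1 : R) H (h z)) ->
  (\int[mu]_(z in U01) (h z)%:E = (H 1 - H 0)%:E)%E.
Proof.
move=> ch dH.
have cH : continuous H.
  move=> z; apply: differentiable_continuous; apply/derivable1_diffP.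
  by have [] := dH z.
rewrite -(@integral_itv_bndoo R 0 1 (EFin \o h) true false); last first.
  apply: measurable_funTS; apply/measurable_EFinP.
  exact: continuous_measurable_fun.
rewrite (@continuous_FTC2 R h H 0 1)//.
- by apply: continuous_subspaceT.
- split.
  + by move=> z _; have [] := dH z.
  + by apply: cvg_at_right_filter; exact: cH.
  + by apply: cvg_at_left_filter; exact: cH.
- by move=> z _; rewrite derive1E; have [_ ->] := dH z.
Qed.

Let Sc (a z : R) := a^-1 * sin (a * z).

Let is_derive_Sc a z : a != 0 -> is_derive (z : R) (1 : R) (Sc a) (cos (a * z)).
Proof.
move=> a0.
have d1 : is_derive (z : R) (1 : R) (fun y : R => a * y) a.
  by apply: (is_derive_eq (is_deriveZ a (is_derive_id z 1))); rewrite /GRing.scale/= mulr1.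
have d2 := is_derive1_comp (is_derive_sin (a * z)) d1.
apply: (is_derive_eq (is_deriveZ a^-1 d2)).
by rewrite /GRing.scale/= mulrC mulfK.
Qed.

Let continuous_cosM (a : R) : continuous (fun z => cos (a * z)).
Proof.
move=> z; apply: continuous_comp; last exact: continuous_cos.
exact: mulrl_continuous.
Qed.

Lemma sin_natpi k : sin (k%:R * pi : R) = 0.
Proof.
elim: k => [|k IH]; first by rewrite mul0r sin0.
by rewrite -natr1 mulrDl mul1r sinD IH sinpi mul0r mulr0 addr0.
Qed.

(** Since [2 sin(jt) sin(kt) = cos((j-k)t) - cos((j+k)t)], a primitive is a
    difference of sines that vanish at both ends, except that the first cosine is
    1 when [j = k]. *)
Lemma integral_sin_sin j k : (0 < j)%N -> (0 < k)%N ->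
  (\int[mu]_(z in U01) (2 * (sin (j%:R * pi * z) * sin (k%:R * pi * z)))%:E =
    ((j == k)%:R)%:E)%E.
Proof.
move=> j0 k0.
pose a : R := j%:R * pi - k%:R * pi; pose b : R := j%:R * pi + k%:R * pi.
have E z : 2 * (sin (j%:R * pi * z) * sin (k%:R * pi * z)) =
    cos (a * z) - cos (b * z).
  have -> : a * z = j%:R * pi * z - k%:R * pi * z by rewrite /a mulrBl.
  have -> : b * z = j%:R * pi * z + k%:R * pi * z by rewrite /b mulrDl.
  by rewrite cosB cosD; ring.
under eq_integral do rewrite E.
have b0 : b != 0.
  by rewrite gt_eqF// /b -mulrDl mulr_gt0 ?pi_gt0// -natrD ltr0n addn_gt0 j0.
have sb : sin b = 0 by rewrite /b -mulrDl -natrD sin_natpi.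
have cc : continuous (fun z => cos (a * z) - cos (b * z)).
  by move=> z; apply: continuousB; exact: continuous_cosM.
have [jk|jk] := eqVneq j k.
- have a0 : a = 0 by rewrite /a jk subrr.
  have dH (z : R) : is_derive z (1 : R) (fun y => y - Sc b y) (cos (a * z) - cos (b * z)).
    rewrite a0 mul0r cos0.
    exact: (is_deriveB (is_derive_id z 1) (is_derive_Sc z b0)).
  rewrite (integral01_FTC cc dH).
  by rewrite /Sc !mulr1 !mulr0 sin0 sb !mulr0 !subr0.
- have a0 : a != 0.
    rewrite /a -mulrBl mulf_neq0//; first by rewrite subr_eq0 eqr_nat.
    by rewrite gt_eqF// pi_gt0.
  have sa : sin a = 0 by rewrite /a sinB !sin_natpi mul0r mulr0 subrr.
  have dH (z : R) : is_derive z (1 : R) (fun y => Sc a y - Sc b y)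
      (cos (a * z) - cos (b * z)).
    exact: (is_deriveB (is_derive_Sc z a0) (is_derive_Sc z b0)).
  rewrite (integral01_FTC cc dH).
  by rewrite /Sc !mulr1 !mulr0 sin0 sa sb !mulr0 !subr0.
Qed.

Lemma continuous_sinM (a : R) : continuous (fun z => sin (a * z)).
Proof.
move=> z; apply: continuous_comp; last exact: continuous_sin.
exact: mulrl_continuous.
Qed.

Lemma w_kernel k : (0 < k)%N -> is_kernel (@w R k).
Proof.
move=> k0.
have mw : measurable_fun setT (@w R k).
  apply: measurable_funM => //; apply: measurable_funX.
  by apply: continuous_measurable_fun; exact: continuous_sinM.
split.
- exact: measurable_funTS.
- by apply: aeW => z _; rewrite /w mulr_ge0// sqr_ge0.
- rewrite (@integral_itv_bndoo R 0 1 (EFin \o @w R k)); last first.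
    by apply: measurable_funTS; exact/measurable_EFinP.
  by have := integral_sin_sin k0 k0; rewrite eqxx.
Qed.

Lemma cmeasurable_phi (D : set R) k : cmeasurable D (@phi R k).
Proof.
split; apply: measurable_funTS => /=.
- apply: measurable_funM => //.
  by apply: continuous_measurable_fun; exact: continuous_sinM.
- exact: measurable_cst.
Qed.

Lemma abs2_phi k z : abs2 (@phi R k z) = w k z.
Proof. by rewrite abs2E /phi/= expr0n addr0 exprMn sqr_sqrtr. Qed.

Lemma L2_phi k : (0 < k)%N -> L2 U01 (@phi R k).
Proof.
move=> k0; split; first exact: cmeasurable_phi.
under eq_integral do rewrite abs2_phi.
have -> : (\int[mu]_(z in U01) (w k z)%:E = 1)%E; last by rewrite ltry.
by have := integral_sin_sin k0 k0; rewrite eqxx.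
Qed.

Lemma L2inner_phi j k : (0 < j)%N -> (0 < k)%N ->
  L2inner U01 (@phi R j) (@phi R k) = (j == k)%:R.
Proof.
move=> j0 k0; rewrite /L2inner /cintegral.
have Re_prod z : complex.Re (phi j z * ((phi k z)^*)%R) =
    2 * (sin (j%:R * pi * z) * sin (k%:R * pi * z)) :> R.
  rewrite /phi/= mul0r subr0 mulrACA -expr2 sqr_sqrtr//.
have Im_prod z : complex.Im (phi j z * ((phi k z)^*)%R) = 0 :> R.
  by rewrite /phi/= oppr0 mulr0 mul0r addr0.
under eq_Rintegral do rewrite Re_prod.
under [X in (_ +i* X)%C]eq_Rintegral do rewrite Im_prod.
rewrite /Rintegral integral_sin_sin// integral0/=.
by case: (j == k).
Qed.

End sines.

(** * Kernels are the squared moduli of unit vectors *)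

Section kernels.
Context {R : realType}.
Local Notation mu := (@lebesgue_measure R).
Local Notation U01 := (`]0%R, 1%R[%classic : set R).
Variables (f : R -> R) (hf : is_density f).
Local Notation F := (cdf_of f).

Lemma integral_cc01 (h : R -> \bar R) : measurable_fun U01 h ->
  (\int[mu]_(z in `[0%R, 1%R]) h z = \int[mu]_(z in U01) h z)%E.
Proof. by move=> mh; rewrite (@integral_itv_bndoo R 0 1 h true false). Qed.

Lemma unit_vector_integral g : unit_vector U01 g ->
  (\int[mu]_(z in U01) (abs2 (g z))%:E = 1)%E.
Proof.
move=> [[mg goo]]; rewrite /L2norm /Rintegral => s1.
have I0 : (0 <= \int[mu]_(z in U01) (abs2 (g z))%:E)%E.
  by apply: integral_ge0 => z _; rewrite lee_fin abs2_ge0.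
rewrite -[LHS]fineK ?ge0_fin_numE//.
by rewrite -[fine _]sqr_sqrtr ?s1 ?expr1n// fine_ge0.
Qed.

Lemma unit_vector_kernel g : unit_vector U01 g -> is_kernel (fun z => abs2 (g z)).
Proof.
move=> ug; have [[mg _] _] := ug; have ma := measurable_abs2 mg.
split.
- exact: measurable_fun_cc01.
- by apply: aeW => z _; exact: abs2_ge0.
- by rewrite integral_cc01 ?unit_vector_integral//; exact/measurable_EFinP.
Qed.

Lemma abs2_Uop_rho g : ae_eq mu setT (fun x => abs2 (Uop f g x))
  (rho (fun z => abs2 (g z)) f).
Proof.
move: (density_ae_pospart hf); apply: filterS => x /(_ Logic.I) ffp _.
by rewrite abs2_Uop /rho -ffp.
Qed.

(** The square root of a kernel is a unit vector. *)
Lemma rho_kernel_Uop v : is_kernel v -> exists2 g : R -> R[i], unit_vector U01 g &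
  ae_eq mu setT (rho v f) (fun x => abs2 (Uop f g x)).
Proof.
move=> [mv v0 v1]; pose g z : R[i] := (Num.sqrt (v z))%:C%C.
have U01_sub : U01 `<=` `[0%R, 1%R] by exact: subset_itv_oo_cc.
have mv01 : measurable_fun U01 v by exact: measurable_funS mv.
have v0' : {ae mu, forall z, U01 z -> 0 <= v z}.
  by move: v0; apply: filterS => z h /U01_sub.
have abs2g z : abs2 (g z) = pospart v z.
  by rewrite abs2E /g/= expr0n addr0 sqr_sqrt_pospart.
have mg : cmeasurable U01 g.
  split => /=; last exact: measurable_cst.
  apply: (@measurableT_comp _ _ _ R R R (@Num.sqrt R) _ v) => //.
  by apply: continuous_measurable_fun; exact: sqrt_continuous.
have I1 : (\int[mu]_(z in U01) (abs2 (g z))%:E = 1)%E.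
  rewrite -v1 integral_cc01; last exact/measurable_EFinP.
  apply: ae_eq_integral => //.
  - by apply/measurable_EFinP; exact: measurable_abs2.
  - exact/measurable_EFinP.
  - move: v0'; apply: filterS => z h /h vz0.
    by rewrite abs2g /pospart max_l.
exists g.
  split; last by rewrite /L2norm /Rintegral I1/= sqrtr1.
  by split=> //; rewrite I1 ltry.
have := ae_cdf hf v0'; have := density_ae_pospart hf.
apply: filterS2 => x /(_ Logic.I) ffp h _.
rewrite abs2_Uop abs2g /rho -ffp; have [fx|fx] := ltP 0 (f x).
  by have [_ vF] := h fx; rewrite /pospart max_l.
have -> : f x = 0 by apply/eqP; rewrite eq_le fx ffp pospart_ge0.
by rewrite !mulr0.
Qed.

Lemma rho_kernel_set :
  [set h : R -> R | exists2 v : R -> R, is_kernel v & ae_eq mu setT h (rho v f)]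
  = [set h : R -> R | exists2 g : R -> R[i], unit_vector U01 g
         & ae_eq mu setT h (fun x => abs2 (Uop f g x))].
Proof.
apply/seteqP; split => h /= [].
- move=> v /rho_kernel_Uop[g ug vg] hv; exists g => //.
  by move: hv vg; apply: filterS2 => x /(_ Logic.I) -> /(_ Logic.I) -> _.
- move=> g ug hg; exists (fun z => abs2 (g z)); first exact: unit_vector_kernel.
  by move: hg (abs2_Uop_rho g); apply: filterS2 => x /(_ Logic.I) -> /(_ Logic.I) -> _.
Qed.

End kernels.

(** * Polynomials converging to a step *)

Section step_polynomials.
Context {R : realType}.

(** On [0, 1] these tend to the indicator of [s < 1/2] away from [1/2], with
    values in [0, 1]: Bernoulli's inequality compares them with [(2 s)^n].  They
    replace the Weierstrass theorem in the proof of completeness. *)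
Definition step_poly n (s : R) := (1 - s ^+ n) ^+ (2 ^ n)%N.

Lemma bernoulli_lower (y : R) N : 0 <= y <= 1 -> 1 - N%:R * y <= (1 - y) ^+ N.
Proof.
move=> /andP[y0 y1]; elim: N => [|N IH]; first by rewrite mul0r subr0 expr0.
rewrite exprS; apply: (@le_trans _ _ ((1 - y) * (1 - N%:R * y))); last first.
  by rewrite ler_wpM2l// subr_ge0.
rewrite -natr1 -subr_ge0 (_ : _ - _ = N%:R * y ^+ 2); last by ring.
by rewrite mulr_ge0// sqr_ge0.
Qed.

(** From [(1 - y) (1 + (N + 1) y) <= 1 + N y], by induction. *)
Lemma bernoulli_upper (y : R) N : 0 <= y <= 1 -> (1 - y) ^+ N * (1 + N%:R * y) <= 1.
Proof.
move=> /andP[y0 y1]; elim: N => [|N IH]; first by rewrite mul0r addr0 expr0 mulr1.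
apply: le_trans IH; rewrite exprSr -mulrA ler_wpM2l ?exprn_ge0 ?subr_ge0//.
rewrite -natr1 -subr_ge0 (_ : _ - _ = (N%:R + 1) * y ^+ 2); last by ring.
by rewrite mulr_ge0// ?sqr_ge0// addr_ge0.
Qed.

Lemma step_poly01 n s : 0 <= s <= 1 -> 0 <= step_poly n s <= 1.
Proof.
move=> /andP[s0 s1]; have s01 : 0 <= 1 - s ^+ n <= 1.
  by rewrite subr_ge0 exprn_ile1// gerBl exprn_ge0.
by case/andP: s01 => a b; rewrite /step_poly exprn_ge0// exprn_ile1.
Qed.

Lemma step_poly_cvg1 s : 0 <= s < 1 / 2 -> step_poly n s @[n --> \oo] --> (1 : R).
Proof.
move=> /andP[s0 s1].
have s01 : 0 <= s <= 1 by rewrite s0/=; lra.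
apply: (@squeeze_cvgr _ _ _ _ (fun n => 1 - (2 * s) ^+ n) (cst 1)).
- apply: nearW => n; have /andP[_ ->] := step_poly01 n s01; rewrite andbT.
  rewrite exprMn /step_poly (le_trans _ (bernoulli_lower _ _))// ?natrX//.
  by rewrite exprn_ge0// exprn_ile1//; lra.
- rewrite -[X in _ --> X]subr0; apply: cvgB; first exact: cvg_cst.
  by apply: cvg_expr; rewrite ger0_norm; lra.
- exact: cvg_cst.
Qed.

Lemma step_poly_cvg0 s : 1 / 2 < s <= 1 -> step_poly n s @[n --> \oo] --> (0 : R).
Proof.
move=> /andP[s0 s1].
have s01 : 0 <= s <= 1 by rewrite s1 andbT; lra.
apply: (@squeeze_cvgr _ _ _ _ (cst 0) (fun n => ((2 * s)^-1) ^+ n)).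
- apply: nearW => n; have /andP[-> _] := step_poly01 n s01 => /=.
  have sn : 0 <= s ^+ n <= 1 by rewrite exprn_ge0 ?exprn_ile1//; lra.
  have p0 : 0 < (2 * s) ^+ n by rewrite exprn_gt0//; lra.
  rewrite exprVn -[leRHS]mul1r ler_pdivlMr//.
  apply: le_trans (bernoulli_upper (2 ^ n) sn).
  rewrite /step_poly ler_wpM2l//; last by rewrite exprMn natrX lerDr.
  by rewrite exprn_ge0// subr_ge0; case/andP: sn.
- exact: cvg_cst.
- apply: cvg_expr; rewrite ger0_norm ?invr_ge0; last by lra.
  by rewrite invf_lt1; lra.
Qed.

End step_polynomials.

(** * Completeness of the modes *)

Section sine_basis.
Context {R : realType}.
Local Notation mu := (@lebesgue_measure R).
Local Notation U01 := (`]0%R, 1%R[%classic : set R).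
Variables (f : R -> R) (hf : is_density f).
Local Notation F := (cdf_of f).
Local Notation fp := (pospart f).

(** The real function whose complex embedding is [psi_ f k.+1]. *)
Definition sine_mode k x : R := Num.sqrt 2 * sin (k.+1%:R * pi * F x) * Num.sqrt (f x).
Local Notation e := sine_mode.
Definition cos_cdf x : R := cos (pi * F x).
Definition mode_weight x : R := sin (pi * F x) * Num.sqrt (f x).
Local Notation c := cos_cdf.
Local Notation u := mode_weight.

Lemma psi_sine_mode k x : psi_ f k.+1 x = (e k x)%:C%C.
Proof. by rewrite /psi_ /Uop /phi -rmorphM. Qed.

(** An inductive span: stability under products is proved by induction, and
    coefficients are extracted only once. *)
Inductive mode_span : (R -> R) -> Prop :=
| mode_span_base k : mode_span (e k)
| mode_spanD r q : mode_span r -> mode_span q -> mode_span (fun x => r x + q x)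
| mode_spanZ a r : mode_span r -> mode_span (fun x => a * r x).
Local Notation sp := mode_span.

(** The sum has the same value for every large number of terms, which allows two
    elements of the span to be written with a common number of terms. *)
Lemma mode_span_sum r : sp r -> exists n (a : nat -> R),
  forall m, (n <= m)%N -> r = fun x => \sum_(k < m) a k * e k x.
Proof.
elim=> [k|r1 q _ [n [a ra]] _ [n' [b qb]]|b r1 _ [n [a ra]]].
- exists k.+1, (fun j => (j == k)%:R) => m km; apply/funext => x.
  rewrite (bigD1 (Ordinal km))//= eqxx mul1r big1 ?addr0// => j jk.
  case: eqP => [jk'|_]; last by rewrite mul0r.
  by case/negP: jk; apply/eqP/val_inj.
- exists (maxn n n'), (fun k => a k + b k) => m.
  rewrite geq_max => /andP[nm n'm]; apply/funext => x.
  rewrite {1}(ra m nm) {1}(qb m n'm) -big_split; apply: eq_bigr => k _.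
  by rewrite mulrDl.
- exists n, (fun k => b * a k) => m nm; apply/funext => x.
  rewrite {1}(ra m nm) mulr_sumr; apply: eq_bigr => k _.
  by rewrite mulrA.
Qed.

Lemma measurable_sine_cdf (a : R) : measurable_fun setT (fun x => sin (a * F x)).
Proof.
apply: (@measurableT_comp _ _ _ R R R (fun z => sin (a * z))).
  by apply: continuous_measurable_fun; exact: continuous_sinM.
exact: (cdf_measurable hf).
Qed.

Lemma measurable_mode_weight : measurable_fun setT u.
Proof.
apply: measurable_funM; first exact: measurable_sine_cdf.
exact: measurable_sqrt_density.
Qed.

Lemma measurable_mode_span r : sp r -> measurable_fun setT r.
Proof.
elim=> [k|r1 q _ mr _ mq|a r1 _ mr].
- apply: measurable_funM; last exact: measurable_sqrt_density.
  by apply: measurable_funM => //; exact: measurable_sine_cdf.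
- exact: measurable_funD.
- exact: measurable_funM.
Qed.

(** From [2 cos t sin((k+1)t) = sin((k+2)t) + sin(kt)]. *)
Lemma mode_span_cos r : sp r -> sp (fun x => c x * r x).
Proof.
elim=> [[|k]|r1 q _ sr _ sq|a r1 _ sr].
- have -> : (fun x => c x * e 0 x) = fun x => 1 / 2 * e 1 x.
    apply/funext => x; rewrite /c /e.
    have -> : 2%:R * pi * F x = pi * F x + pi * F x by ring.
    by rewrite sinD !mul1r; field.
  exact/mode_spanZ/mode_span_base.
- have -> : (fun x => c x * e k.+1 x) = fun x => 1 / 2 * (e k.+2 x + e k x).
    apply/funext => x; rewrite /c /e.
    have -> : k.+3%:R * pi * F x = k.+2%:R * pi * F x + pi * F x.
      by rewrite -natr1; ring.
    have -> : k.+1%:R * pi * F x = k.+2%:R * pi * F x - pi * F x.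
      by rewrite -[k.+2%:R]natr1; ring.
    by rewrite sinD sinB; field.
  by apply: mode_spanZ; apply: mode_spanD; exact: mode_span_base.
- have -> : (fun x => c x * (r1 x + q x)) = fun x => c x * r1 x + c x * q x.
    by apply/funext => x; rewrite mulrDr.
  exact: mode_spanD.
- have -> : (fun x => c x * (a * r1 x)) = fun x => a * (c x * r1 x).
    by apply/funext => x; rewrite mulrCA.
  exact: mode_spanZ.
Qed.

Definition multiplier (p : R -> R) := forall r, sp r -> sp (fun x => p x * r x).

Lemma multiplier_affine (a b : R) p : multiplier p -> multiplier (fun x => a + b * p x).
Proof.
move=> mp r sr.
have -> : (fun x => (a + b * p x) * r x) = fun x => a * r x + b * (p x * r x).
  by apply/funext => x; ring.
by apply: mode_spanD; apply: mode_spanZ => //; exact: mp.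
Qed.

Lemma multiplierX p n : multiplier p -> multiplier (fun x => p x ^+ n).
Proof.
move=> mp; elim: n => [|n IH] r sr.
  have -> : (fun x => p x ^+ 0 * r x) = r by apply/funext => x; rewrite mul1r.
  exact: sr.
have -> : (fun x => p x ^+ n.+1 * r x) = fun x => p x * (p x ^+ n * r x).
  by apply/funext => x; rewrite exprS mulrA.
by apply: mp; exact: IH.
Qed.

Lemma mode_span_weight : sp u.
Proof.
have -> : u = fun x => (Num.sqrt 2)^-1 * e 0 x.
  apply/funext => x; rewrite /e mul1r -mulrA mulKf// gt_eqF// sqrtr_gt0//.
exact/mode_spanZ/mode_span_base.
Qed.

Let V := L2_adherent sp.

Let piF x : 0 <= pi * F x <= (pi : R).
Proof.
have p0 := pi_ge0 R.
by rewrite mulr_ge0 ?cdf_ge0//= -[leRHS]mulr1 ler_wpM2l// cdf_le1.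
Qed.

Lemma mode_weight_ge0 x : 0 <= u x.
Proof. by rewrite mulr_ge0 ?sqrtr_ge0// sin_ge0_pi. Qed.

Lemma sqint_mode_weight : (sqint u < +oo)%E.
Proof.
apply: (@le_lt_trans _ _ (\int[mu]_x (fp x)%:E)%E); last first.
  by rewrite integral_pospartT ?ltry.
apply: ge0_le_integral => //.
- by move=> x _; rewrite lee_fin sqr_ge0.
- by apply: measurable_sqE; exact: measurable_mode_weight.
- by apply/measurable_EFinP; exact: (measurable_pospart (density_measurable hf)).
- move=> x _; rewrite lee_fin /u exprMn sqr_sqrt_pospart.
  by rewrite -[leRHS]mul1r ler_wpM2r ?pospart_ge0// sin2cos2 gerBl sqr_ge0.
Qed.

(** Flat pieces of [F] carry no mass. *)
Lemma negligible_cdf_level (z : R) : {ae mu, forall x, 0 < f x -> F x <> z}.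
Proof.
have : {ae mu, forall y, U01 y -> y <> z}.
  exists [set z]; split; [exact: measurable_set1|exact: lebesgue_measure_set1|].
  by move=> y /= h; apply: contrapT => yz; apply: h.
by move=> /(ae_cdf hf); apply: filterS => x h /h[].
Qed.

(** As [F] is nondecreasing and the cosine decreases on [0, pi], the condition
    [x > a] is almost [cos(pi F x) < cos(pi F a)]; the two differ only where
    [F x = F a], a set without mass. *)
Lemma adherent_ray a : V (fun x => u x * \1_(`]a, +oo[%classic) x).
Proof.
pose t := c a.
(* Affine in the cosine, equal to 1/2 at the level of [a], and with values in
   [0, 1] because two cosines differ by at most 2. *)
pose s x : R := (2 - t) / 4 + 1 / 4 * c x.
have cle x : -1 <= c x <= 1 by rewrite cos_geN1 cos_le1.
have s01 x : 0 <= s x <= 1.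
  by have := cle x; have := cle a; rewrite /s /t; lra.
have smult n : multiplier (fun x => step_poly n (s x)).
  rewrite /step_poly; apply: multiplierX.
  have -> : (fun x => 1 - s x ^+ n) = (fun x => 1 + -1 * s x ^+ n).
    by apply/funext => x; rewrite mulN1r.
  apply: multiplier_affine; apply: multiplierX; apply: multiplier_affine.
  exact: mode_span_cos.
have VD n : V (fun x => step_poly n (s x) * u x).
  apply: adherent_sub; first exact: measurable_mode_span.
  exact: smult mode_span_weight.
apply: (adherent_dominated measurable_mode_span VD).
- apply: measurable_funM; first exact: measurable_mode_weight.
  by apply: measurable_indic; exact: measurable_itv.
- exact: measurable_mode_weight.
- exact: sqint_mode_weight.
- move: (negligible_cdf_level (F a)); apply: filterS => x Fxa.
  have [fx|fx] := leP (f x) 0.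
    have ux : u x = 0 by rewrite /u ler0_sqrtr ?mulr0.
    by rewrite ux mul0r; under eq_cvg do rewrite mulr0; exact: cvg_cst.
  have {}Fxa := Fxa fx.
  have pF := pi_gt0 R.
  have cosF : c x < t = (F a < F x).
    by rewrite /t /c ltr_cos ?in_itv/= ?piF// ltr_pM2l.
  have cosF' : t < c x = (F x < F a).
    by rewrite /t /c ltr_cos ?in_itv/= ?piF// ltr_pM2l.
  have [xa|ax] := leP x a.
    rewrite indicE memNset ?mulr0; last by rewrite /= in_itv/= andbT; apply/negP; rewrite -leNgt.
    rewrite -[X in _ --> X](mul0r (u x)); apply: cvgMl.
    apply: step_poly_cvg0; have /andP[_ ->] := s01 x; rewrite andbT.
    have : t < c x.
      rewrite cosF' lt_neqAle cdf_nd// andbT; exact/eqP.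
    by rewrite /s; lra.
  rewrite indicE mem_set ?mulr1; last by rewrite /= in_itv/= andbT.
  rewrite -[X in _ --> X](mul1r (u x)); apply: cvgMl.
  apply: step_poly_cvg1; have /andP[-> _] := s01 x => /=.
  have : c x < t.
    by rewrite cosF lt_neqAle cdf_nd ?andbT ?ltW//; apply/eqP => h; apply: Fxa.
  by rewrite /s; lra.
- move=> n x; have /andP[p0 p1] := step_poly01 n (s01 x).
  rewrite ger0_norm; last exact: (mulr_ge0 p0 (mode_weight_ge0 x)).
  by rewrite -[leRHS]mul1r ler_wpM2r ?mode_weight_ge0.
- move=> x; rewrite indicE; case: (_ \in _); rewrite ?mulr1 ?mulr0 ?normr0 ?mode_weight_ge0//.
  by rewrite ger0_norm ?mode_weight_ge0.
Qed.

Lemma adherent_supp r : measurable_fun setT r -> (sqint r < +oo)%E ->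
  (forall x, ~ supp f x -> r x = 0) -> V r.
Proof.
move=> mr roo rsupp.
apply: (@adherent_full _ sp measurable_mode_span mode_spanD mode_spanZ u) => //.
- by apply: adherent_sub; [exact: measurable_mode_span|exact: mode_span_weight].
- exact: mode_weight_ge0.
- exact: sqint_mode_weight.
- exact: adherent_ray.
- have : {ae mu, forall y, U01 y -> True} by exact: aeW.
  move=> /(ae_cdf hf); apply: filterS => x h ux; apply: rsupp => sx.
  have [+ _] := h sx; rewrite /= in_itv/= => /andP[F0 F1].
  have pF := pi_gt0 R.
  have : 0 < u x.
    rewrite mulr_gt0 ?sqrtr_gt0// sin_gt0_pi// mulr_gt0//=.
    by rewrite -[ltRHS]mulr1 ltr_pM2l.
  by rewrite ux ltxx.
Qed.

Lemma sqint_restrict (D : set R) r : measurable D ->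
  sqint (r \_ D) = (\int[mu]_(x in D) ((r x) ^+ 2)%:E)%E.
Proof.
move=> mD; rewrite [RHS]integral_mkcond; apply: eq_integral => x _.
by rewrite !patchE; case: ifP; rewrite ?expr0n.
Qed.

Lemma sine_basis : orthonormal_basis (supp f) (fun k => psi_ f k.+1).
Proof.
have ms := measurable_supp hf.
split.
- by move=> k; apply: (L2_Uop hf) => //; exact: L2_phi.
- move=> j k; rewrite (L2inner_Uop hf)//; try exact: cmeasurable_phi.
  by rewrite L2inner_phi// eqSS.
move=> psi [[mpr mpi] psioo] eps eps0.
pose r1 : R -> R := (fun x => complex.Re (psi x)) \_ (supp f).
pose r2 : R -> R := (fun x => complex.Im (psi x)) \_ (supp f).
have ma := measurable_abs2 (conj mpr mpi : cmeasurable _ psi).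
have part_le (p : R[i] -> R) : measurable_fun (supp f) (fun x => p (psi x)) ->
    (forall z, p z ^+ 2 <= abs2 z) ->
    V ((fun x => p (psi x)) \_ (supp f)).
  move=> mp le; apply: adherent_supp.
  - exact/(measurable_restrictT _ ms).
  - rewrite sqint_restrict//; apply: le_lt_trans psioo.
    apply: ge0_le_integral => //.
    + by move=> x _; rewrite lee_fin sqr_ge0.
    + by apply/measurable_EFinP; exact: measurable_funX.
    + exact/measurable_EFinP.
    + by move=> x _; rewrite lee_fin.
  - by move=> x sx; rewrite patchE memNset.
have e2 : 0 < eps ^+ 2 / 2 by rewrite divr_gt0// exprn_gt0.
have [mr1 /(_ _ e2)[q1 sq1 h1]] : V r1.
  by apply: part_le => // z; rewrite abs2E lerDl sqr_ge0.
have [mr2 /(_ _ e2)[q2 sq2 h2]] : V r2.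
  by apply: part_le => // z; rewrite abs2E lerDr sqr_ge0.
have [n1 [a q1E]] := mode_span_sum sq1; have [n2 [b q2E]] := mode_span_sum sq2.
pose n := maxn n1 n2; exists n, (fun k => (a k +i* b k)%C).
have {}q1E := q1E n (leq_maxl _ _); have {}q2E := q2E n (leq_maxr _ _).
have sumE x : \sum_(k < n) (a k +i* b k)%C * psi_ f k.+1 x = (q1 x +i* q2 x)%C.
  rewrite q1E q2E; elim: (n) => [|m IH]; first by rewrite !big_ord0.
  rewrite !big_ord_recr/= IH psi_sine_mode; apply/eqP; rewrite eq_complex/=.
  by rewrite !mulr0 subr0 add0r !eqxx.
have mq1 := measurable_mode_span sq1; have mq2 := measurable_mode_span sq2.
have Ile : (\int[mu]_(x in supp f)
    (abs2 (psi x - \sum_(k < n) (a k +i* b k)%C * psi_ f k.+1 x))%:E < (eps ^+ 2)%:E)%E.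
  apply: (@le_lt_trans _ _ (sqint (fun x => (r1 x - q1 x)%R) +
      sqint (fun x => (r2 x - q2 x)%R))%E); last first.
    have -> : eps ^+ 2 = eps ^+ 2 / 2 + eps ^+ 2 / 2 by lra.
    by rewrite [ltRHS]EFinD; apply: lteD.
  have m1 : measurable_fun setT (fun x => ((r1 x - q1 x) ^+ 2)%:E).
    by apply: measurable_sqE; apply: measurable_funB.
  have m2 : measurable_fun setT (fun x => ((r2 x - q2 x) ^+ 2)%:E).
    by apply: measurable_sqE; apply: measurable_funB.
  rewrite /sqint -ge0_integralD//; last 2 first.
    by move=> x _; rewrite lee_fin sqr_ge0.
    by move=> x _; rewrite lee_fin sqr_ge0.
  apply: (@le_trans _ _ (\int[mu]_(x in supp f) (((r1 x - q1 x) ^+ 2)%:E +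
      ((r2 x - q2 x) ^+ 2)%:E))%E).
    rewrite le_eqVlt; apply/orP; left; apply/eqP.
    apply: eq_integral => x; rewrite inE => sx.
    rewrite sumE abs2E -EFinD /r1 /r2 !patchE mem_set//.
    by case: (psi x).
  apply: ge0_subset_integral => //.
  - exact: emeasurable_funD.
  - by move=> x _; rewrite -EFinD lee_fin addr_ge0 ?sqr_ge0.
rewrite /L2norm /Rintegral -[ltRHS]gtr0_norm// -sqrtr_sqr ltr_sqrt ?exprn_gt0//.
rewrite -lte_fin fineK// ge0_fin_numE; first by rewrite (lt_trans Ile) ?ltry.
by apply: integral_ge0 => x _; rewrite lee_fin abs2_ge0.
Qed.

End sine_basis.

(** * Monotone differentiable changes of variables *)

Lemma is_derive_seq (R : realType) (g : R -> R) (y l : R) :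
  is_derive y (1 : R) g l ->
  n.+1%:R * (g (y + n.+1%:R^-1) - g y) @[n --> \oo] --> l.
Proof.
move=> [dg <-].
have h0 : (n.+1%:R^-1 : R) @[n --> \oo] --> (0 : R)^'.
  move=> A /cvg_harmonic[N _ hN]; exists N => // n /hN /=; apply.
  by rewrite invr_neq0.
have := cvg_comp _ _ h0 dg.
apply: cvg_trans; apply: near_eq_cvg; near=> n => /=.
by rewrite invrK /GRing.scale/= mulr1 [n.+1%:R^-1 + y]addrC.
Unshelve. all: by end_near. Qed.

Section monotone_pairs.
Context {R : realType}.
Local Notation mu := (@lebesgue_measure R).

(** Symmetric in the two maps, so that what is proved of one direction can be
    applied to the other. *)
Definition monotone_pair (I J : set R) (T S : R -> R) : Prop :=
  [/\ open I, open J, forall x, I x -> J (T x) /\ S (T x) = x,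
      forall y, J y -> I (S y) /\ T (S y) = y
    & ((forall x x', I x -> I x' -> x <= x' -> T x <= T x') /\
       (forall y y', J y -> J y' -> y <= y' -> S y <= S y')) \/
      ((forall x x', I x -> I x' -> x <= x' -> T x' <= T x) /\
       (forall y y', J y -> J y' -> y <= y' -> S y' <= S y))].

Lemma monotone_pair_sym I J T S : monotone_pair I J T S -> monotone_pair J I S T.
Proof. by case=> oI oJ hT hS mono; split=> //; case: mono => -[? ?]; [left|right]. Qed.

(** The derivative is a pointwise limit of difference quotients. *)
Lemma derivable_measurable (A : set R) (g g' : R -> R) : open A ->
  (forall x, A x -> is_derive x (1 : R) g (g' x)) ->
  measurable_fun A g /\ measurable_fun A g'.
Proof.
move=> oA dg.
have mA : measurable A by exact: open_measurable.
have mg : measurable_fun A g.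
  apply: open_continuous_measurable_fun => // x; rewrite inE => /dg[d _].
  by apply: differentiable_continuous; exact/derivable1_diffP.
split => //.
pose ge := g \_ A.
have mge : measurable_fun setT ge by exact/(measurable_restrictT _ mA).
apply: (@measurable_fun_cvg _ R R A
  (fun (n : nat) (x : R) => n.+1%:R * (ge (x + n.+1%:R^-1) - ge x)) g').
  move=> n; apply: measurable_funTS; apply: measurable_funM => //.
  apply: measurable_funB => //; apply: (measurableT_comp mge).
  exact: measurable_funD.
move=> x Ax; have := is_derive_seq (dg x Ax).
apply: cvg_trans; apply: near_eq_cvg.
have : \forall h \near (0 : R), A (x + h).
  have cD : x + h @[h --> (0 : R)] --> x + 0.
    by apply: cvgD; [exact: cvg_cst|exact: cvg_id].
  by apply: cD; rewrite addr0; exact: open_nbhs_nbhs.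
move=> /cvg_harmonic[N _ hN]; exists N => // n /hN /= An.
by rewrite /ge !patchE !mem_set.
Qed.

Section derivative_inequality.
Variables (I J : set R) (T S T' S' : R -> R).
Hypotheses (P : monotone_pair I J T S)
  (dT : forall x, I x -> is_derive x (1 : R) T (T' x))
  (dS : forall y, J y -> is_derive y (1 : R) S (S' y)).

Let oI : open I. Proof. by case: P. Qed.
Let oJ : open J. Proof. by case: P. Qed.
Let mI : measurable I. Proof. exact: open_measurable. Qed.
Let mJ : measurable J. Proof. exact: open_measurable. Qed.
Let hT x : I x -> J (T x) /\ S (T x) = x. Proof. by case: P => _ _ + _ _; apply. Qed.
Let hS y : J y -> I (S y) /\ T (S y) = y. Proof. by case: P => _ _ _ + _; apply. Qed.
Let mT : measurable_fun I T. Proof. by have [] := derivable_measurable oI dT. Qed.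
Let mS : measurable_fun J S. Proof. by have [] := derivable_measurable oJ dS. Qed.
Let mS' : measurable_fun J S'. Proof. by have [] := derivable_measurable oJ dS. Qed.
Let Te := T \_ I.
Let mTe : measurable_fun setT Te.
Proof. exact/(measurable_restrictT _ mI). Qed.

Let mabsS' (A : set R) : A `<=` J -> measurable_fun A (fun y => `|S' y|%:E).
Proof.
move=> AJ; apply/measurable_EFinP; apply: (measurable_funS mJ AJ).
exact: measurableT_comp.
Qed.

Section open_case.
Variables (U : set R) (oU : open U) (UI : U `<=` I).

(** The area of [A n] is computed in two ways.  Vertical sections, of [s] at fixed
    [y], are for large [n] the segment between [S y] and [S (y + 1/(n+1))]: their
    length is a difference quotient of [S].  Horizontal sections, of [y] at fixed
    [s], have length [1/(n+1)]. *)
Let A n : set (R * R) :=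
  [set p | U p.2 /\ (p.1 <= Te p.2 /\ Te p.2 <= p.1 + n.+1%:R^-1)].

Let mA n : measurable (A n).
Proof.
have mTe2 : measurable_fun setT (fun p : R * R => Te p.2).
  by apply: (measurableT_comp mTe); exact: measurable_snd.
have m1 : measurable_fun setT (fun p : R * R => p.1) by exact: measurable_fst.
rewrite (_ : A n = (setT `&` snd @^-1` U) `&`
   ((setT `&` [set p | p.1 <= Te p.2]) `&`
    (setT `&` [set p | Te p.2 <= p.1 + n.+1%:R^-1]))); last first.
  by rewrite !setTI.
apply: measurableI.
  by apply: measurable_snd => //; exact: open_measurable.
apply: measurableI; first exact: measurable_fun_le.
by apply: measurable_fun_le => //; exact: measurable_funD.
Qed.

Let ysecE n s : (mu (ysection (A n) s) = (n.+1%:R^-1)%:E * (\1_U s)%:E)%E.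
Proof.
rewrite indicE; have [sU|sU] := boolP (s \in U); last first.
  rewrite mule0 (_ : ysection _ _ = set0) ?measure0//.
  apply/seteqP; split => y //= /ysectionP[Us _].
  by move: sU; rewrite notin_setE.
rewrite mule1 (_ : ysection _ _ = `[Te s - n.+1%:R^-1, Te s]%classic).
  rewrite lebesgue_measure_itv/= lte_fin ltrBlDr ltrDl invr_gt0 ltr0n/=.
  by rewrite -EFinB opprB addrC subrK.
apply/seteqP; split => y /=.
  by move=> /ysectionP[_ [/= a b]]; rewrite in_itv/= a lerBlDr b.
rewrite in_itv/= lerBlDr => /andP[a b]; apply/ysectionP.
by split; [rewrite inE in sU|].
Qed.

Let g n y : \bar R := ((n.+1%:R)%:E * mu (xsection (A n) y))%E.

Let mxsec n : measurable_fun setT (fun y : R => mu (xsection (A n) y)).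
Proof.
exact: (@measurable_fun_xsection _ _ (measurableTypeR R) (measurableTypeR R) R mu
  _ (mA n)).
Qed.

Let mg n : measurable_fun setT (g n).
Proof. exact: measurable_funeM. Qed.

Let int_g n : (\int[mu]_y g n y = mu U)%E.
Proof.
have mU : measurable U by exact: open_measurable.
rewrite /g ge0_integralZl//; last exact: mxsec.
have := @indic_fubini_tonelli _ _ (measurableTypeR R) (measurableTypeR R) R mu mu _ (mA n).
rewrite (@indic_fubini_tonelli_FE _ _ (measurableTypeR R) (measurableTypeR R) R mu _ (mA n)).
rewrite (@indic_fubini_tonelli_GE _ _ (measurableTypeR R) (measurableTypeR R) R mu _ (mA n)) => E.
rewrite (_ : (\int[mu]_x mu (xsection (A n) x) = \int[mu]_s (mu \o ysection (A n)) s)%E)//.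
under eq_integral do rewrite /= ysecE.
rewrite ge0_integralZl//; last first.
  by apply/measurable_EFinP; exact: measurable_indic.
rewrite integral_indic// setIT muleA -EFinM mulfV ?mul1e//.
Qed.

Let mD : measurable (J `&` S @^-1` U).
Proof. by apply: mS => //; exact: open_measurable. Qed.

Let cvg_g y : (J `&` S @^-1` U) y -> g n y @[n --> \oo] --> (`|S' y|)%:E.
Proof.
move=> [Jy USy].
have cS : S (y + n.+1%:R^-1) @[n --> \oo] --> S y.
  have cSy : {for y, continuous S}.
    have [d _] := dS Jy.
    by apply: differentiable_continuous; exact/derivable1_diffP.
  have cy : y + n.+1%:R^-1 @[n --> \oo] --> y.
    rewrite -[X in _ --> X]addr0.
    by apply: cvgD; [exact: cvg_cst|exact: cvg_harmonic].
  exact: (cvg_comp _ _ cy cSy).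
have nJ : \forall n \near \oo, J (y + n.+1%:R^-1).
  have cy : y + n.+1%:R^-1 @[n --> \oo] --> y.
    rewrite -[X in _ --> X]addr0.
    by apply: cvgD; [exact: cvg_cst|exact: cvg_harmonic].
  by apply: cy; exact: open_nbhs_nbhs.
have [e /= e0 be] : nbhs_ball (S y) U by apply/nbhs_ballP; exact: open_nbhs_nbhs.
have ne : \forall n \near \oo, `|S y - S (y + n.+1%:R^-1)| < e.
  by move/cvgrPdist_lt : cS; exact.
have lim : `|n.+1%:R * (S (y + n.+1%:R^-1) - S y)|%:E @[n --> \oo] --> (`|S' y|)%:E.
  apply: cvg_EFin; first exact: nearW.
  by apply: cvg_norm; exact: is_derive_seq (dS Jy).
apply: cvg_trans lim; apply: near_eq_cvg.
move: nJ ne; apply: filterS2 => n Jn ne.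
pose a := Num.min (S y) (S (y + n.+1%:R^-1)).
pose b := Num.max (S y) (S (y + n.+1%:R^-1)).
have secE : xsection (A n) y = `[a, b]%classic.
  have yn : y <= y + n.+1%:R^-1 by rewrite lerDl invr_ge0.
  have segU s : a <= s <= b -> U s.
    move=> /andP[as_ sb]; apply: be; rewrite /ball/=.
    move: as_ sb ne; rewrite /a /b !ltr_norml.
    case: (leP (S y)) => h h1 h2 /andP[h3 h4]; apply/andP; split; lra.
  have [_ _ _ _ mono] := P.
  have monoE s : I s ->
      (y <= T s /\ T s <= y + n.+1%:R^-1) <-> (a <= s /\ s <= b).
    move=> Is; have [JTs STs] := hT Is; have [ISy TSy] := hS Jy.
    have [ISn TSn] := hS Jn.
    case: mono => -[mT1 mS1]; have hab := mS1 _ _ Jy Jn yn.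
    - rewrite /a /b min_l// max_r//; split=> -[h1 h2].
        by rewrite -STs; split; apply: mS1.
      by split; [rewrite -TSy|rewrite -TSn]; apply: mT1.
    - rewrite /a /b min_r// max_l//; split=> -[h1 h2].
        by rewrite -STs; split; apply: mS1.
      by split; [rewrite -TSy|rewrite -TSn]; apply: mT1.
  apply/seteqP; split => s.
    move=> /xsectionP[/= Us]; rewrite /Te patchE mem_set; last exact: UI.
    by move=> /(monoE _ (UI Us))[h1 h2]; rewrite in_itv/= h1 h2.
  rewrite /= in_itv/= => /andP[h1 h2]; have Us := segU s (introT andP (conj h1 h2)).
  apply/xsectionP; split => //=; rewrite /Te patchE mem_set; last exact: UI.
  exact/(monoE _ (UI Us)).
rewrite /g secE lebesgue_measure_itv/=.
have -> : (if a%:E < b%:E then b%:E - a%:E else 0)%E = (`|S (y + n.+1%:R^-1) - S y|)%:E.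
  rewrite lte_fin /a /b; have [h|h] := leP (S y) (S (y + n.+1%:R^-1)).
    rewrite ger0_norm ?subr_ge0//; case: ltP => // h'.
    by congr EFin; apply/eqP; rewrite eq_sym subr_eq0 eq_le h h'.
  by rewrite h ltr0_norm ?subr_lt0// opprB.
by rewrite normrM -EFinM ger0_norm.
Qed.

(** The functions [g n] have integral [mu U] and converge to [|S'|], so this is
    Fatou's lemma. *)
Lemma integral_derive_le_open :
  (\int[mu]_(y in J `&` S @^-1` U) (`|S' y|)%:E <= mu U)%E.
Proof.
have g0 n y : (0 <= g n y)%E by rewrite mule_ge0// lee_fin.
rewrite (_ : (\int[mu]_(y in J `&` S @^-1` U) (`|S' y|)%:E =
    \int[mu]_(y in J `&` S @^-1` U) limn_einf (g^~ y))%E); last first.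
  apply: eq_integral => y; rewrite inE => Dy.
  have c := cvg_g Dy.
  by rewrite is_cvg_limn_einfE ?(cvg_lim _ c)//; exact: cvgP c.
apply: le_trans (fatou mu mD _ _) _ => //.
- by move=> n; exact: (measurable_funTS (mg n)).
- rewrite limn_einf_lim; apply: lime_le; first exact: is_cvg_einfs.
  apply: nearW => n; apply: (@le_trans _ _ (\int[mu]_(y in J `&` S @^-1` U) g n y)%E).
    by apply: ereal_inf_lbound; exists n => /=.
  rewrite -(int_g n); apply: ge0_subset_integral => //.
  exact: (mg n).
Qed.

End open_case.

(** Outer regularity: [I `&` T @^-1` B] is the image of [B] under [S], and it is
    contained in open sets of almost the same measure. *)
Lemma integral_derive_le (B : set R) : measurable B -> B `<=` J ->
  (\int[mu]_(y in B) (`|S' y|)%:E <= mu (I `&` T @^-1` B))%E.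
Proof.
move=> mB BJ.
have mC : measurable (I `&` T @^-1` B) by exact: mT.
have [Coo|] := ltP (mu (I `&` T @^-1` B)) +oo%E; last first.
  by rewrite leye_eq => /eqP ->; rewrite leey.
apply/lee_addgt0Pr => e e0.
have [U0 [oU0 CU0 Ue]] := lebesgue_regularity_outer mC Coo e0.
pose U := U0 `&` I.
have oU : open U by exact: openI.
have UI : U `<=` I by exact: subIsetr.
have mU : measurable U by exact: open_measurable.
apply: (@le_trans _ _ (\int[mu]_(y in J `&` S @^-1` U) (`|S' y|)%:E)%E).
  apply: ge0_subset_integral => //.
  - by apply: mS.
  - by apply: mabsS'; exact: subIsetl.
  - move=> y By; have Jy := BJ _ By; have [ISy TSy] := hS Jy.
    by split => //; split => //; apply: CU0; split => //; rewrite /= TSy.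
apply: le_trans (integral_derive_le_open oU UI) _.
have CU : I `&` T @^-1` B `<=` U by move=> x Cx; split; [exact: CU0|case: Cx].
have -> : U = (I `&` T @^-1` B) `|` (U `\` (I `&` T @^-1` B)).
  by rewrite setDUK.
apply: le_trans (measureU2 _ _ _) _ => //; first exact: measurableD.
rewrite leeD2l//; apply: le_trans (ltW Ue).
by apply: le_measure; rewrite ?inE; [exact: measurableD|
  apply: measurableD => //; exact: open_measurable|apply: setSD; exact: subIsetl].
Qed.

End derivative_inequality.
End monotone_pairs.


Section change_of_variables_formula.
Context {R : realType}.
Local Notation mu := (@lebesgue_measure R).

(** Extended by 0 in order to be a weight on the whole line. *)
Definition jacobian (J : set R) (S' : R -> R) : R -> R := (fun y => `|S' y|) \_ J.

Lemma jacobian_ge0 J S' y : 0 <= jacobian J S' y.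
Proof. by rewrite /jacobian patchE; case: ifP. Qed.

Lemma measurable_jacobian J S S' : open J ->
  (forall y, J y -> is_derive y (1 : R) S (S' y)) ->
  measurable_fun setT (jacobian J S').
Proof.
move=> oJ dS; apply/(measurable_restrictT _ (open_measurable oJ)).
by apply: measurableT_comp => //; have [] := derivable_measurable oJ dS.
Qed.

Lemma integral_derive_le_fun (I J : set R) (T S T' S' : R -> R) (phi : R -> \bar R) :
  monotone_pair I J T S ->
  (forall x, I x -> is_derive x (1 : R) T (T' x)) ->
  (forall y, J y -> is_derive y (1 : R) S (S' y)) ->
  measurable_fun setT phi -> (forall y, 0 <= phi y)%E ->
  (\int[mu]_y (phi y * (jacobian J S' y)%:E) <=
   \int[mu]_x (phi ((T \_ I) x) * (\1_I x)%:E))%E.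
Proof.
move=> P dT dS mphi phi0; have [oI oJ hT _ _] := P.
have mI := open_measurable oI; have mJ := open_measurable oJ.
have mTe : measurable_fun setT (T \_ I).
  apply/(measurable_restrictT _ mI); by have [] := derivable_measurable oI dT.
apply: (le_integral_of_sets (K := idfun)) => //.
- exact: measurable_id.
- exact: measurable_jacobian dS.
- exact: jacobian_ge0.
- move=> B mB; rewrite preimage_id.
  have -> : (\int[mu]_(y in B) (jacobian J S' y)%:E =
      \int[mu]_(y in B `&` J) (`|S' y|)%:E)%E.
    rewrite integral_mkcondr; apply: eq_integral => y _.
    by rewrite /jacobian !patchE; case: ifP.
  apply: le_trans (integral_derive_le P dT dS _ _) _; [exact: measurableI|
    exact: subIsetr|].
  rewrite integral_indic//; last first.
    by rewrite -[X in measurable X]setTI; exact: mTe.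
  rewrite le_eqVlt; apply/orP; left; apply/eqP; congr (mu _).
  apply/seteqP; split => x /=.
    by move=> [Ix [BT _]]; split => //; rewrite /= patchE mem_set.
  by move=> [Ix]; rewrite /= patchE mem_set// => BT; split => //; split=> //; case: (hT _ Ix).
Qed.

(** The inequality above, applied to both maps, closes up because the two
    Jacobians are inverse to each other; this takes the place of an argument by
    absolute continuity. *)
Lemma monotone_change_of_variables (I J : set R) (T S T' S' : R -> R)
    (phi : R -> \bar R) :
  monotone_pair I J T S ->
  (forall x, I x -> is_derive x (1 : R) T (T' x)) ->
  (forall y, J y -> is_derive y (1 : R) S (S' y)) ->
  (forall x, I x -> S' (T x) * T' x = 1) ->
  measurable_fun setT phi -> (forall y, 0 <= phi y)%E ->
  (\int[mu]_y (phi y * (jacobian J S' y)%:E) =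
   \int[mu]_x (phi ((T \_ I) x) * (\1_I x)%:E))%E.
Proof.
move=> P dT dS TS1 mphi phi0; have [oI oJ hT hS _] := P.
have mI := open_measurable oI; have mJ := open_measurable oJ.
have mTe : measurable_fun setT (T \_ I).
  apply/(measurable_restrictT _ mI); by have [] := derivable_measurable oI dT.
apply/eqP; rewrite eq_le (integral_derive_le_fun P dT dS)//=.
have mj := measurable_jacobian oJ dS.
pose psi x : \bar R := (phi ((T \_ I) x) * (jacobian J S' ((T \_ I) x))%:E)%E.
have mpsi : measurable_fun setT psi.
  apply: emeasurable_funM; first exact: measurableT_comp.
  by apply/measurable_EFinP; exact: measurableT_comp.
have psi0 x : (0 <= psi x)%E by rewrite mule_ge0// lee_fin jacobian_ge0.
have := integral_derive_le_fun (monotone_pair_sym P) dS dT mpsi psi0.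
congr (_ <= _)%E; apply: eq_integral => x _.
- rewrite /psi /jacobian !patchE indicE.
  have [xI|xI] := boolP (x \in I); last by rewrite !mule0.
  have [JT _] := hT _ (set_mem xI).
  by rewrite mem_set// -muleA -EFinM -normrM TS1 ?normr1//; exact: set_mem.
- rewrite /psi /jacobian !patchE indicE.
  have [xJ|xJ] := boolP (x \in J); last by rewrite !mule0.
  have [IS TS] := hS _ (set_mem xJ).
  by rewrite mule1 (mem_set IS) TS xJ.
Qed.

End change_of_variables_formula.

(** * Transport of densities *)

Section pushforward.
Context {R : realType}.
Local Notation mu := (@lebesgue_measure R).
Local Notation U01 := (`]0%R, 1%R[%classic : set R).
Variables (f : R -> R) (hf : is_density f).
Variables (I J : set R) (T : R -> R).
Hypotheses (oI : open_interval I) (oJ : open_interval J)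
  (fI : {ae mu, forall x, supp f x -> I x})
  (TIJ : diff_homeomorphism I J T)
  (T0 : forall x, I x -> derive1 T x != 0).
Local Notation S := (inv_on I T).
Local Notation S' := (derive1 (inv_on I T)).
Local Notation fp := (pospart f).
Local Notation F := (cdf_of f).

Let mI : measurable I. Proof. by apply: open_measurable; case: oI. Qed.
Let mJ : measurable J. Proof. by apply: open_measurable; case: oJ. Qed.

Lemma inv_onK x : I x -> S (T x) = x.
Proof.
move=> Ix; have [[_ Tinj _] _ _ _] := TIJ.
by apply: pinvKV; [exact: Tinj|rewrite inE].
Qed.

Lemma homeo_sub x : I x -> J (T x).
Proof. by move=> Ix; have [[fun_ _ _] _ _ _] := TIJ; apply: fun_. Qed.

Lemma inv_on_sub y : J y -> I (S y) /\ T (S y) = y.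
Proof.
by have [[_ _ surj] _ _ _] := TIJ; move=> /surj[x Ix <-]; rewrite inv_onK.
Qed.

Lemma homeo_derive x : I x -> is_derive x (1 : R) T (derive1 T x).
Proof.
by move=> Ix; have [_ _ _ d] := TIJ; rewrite derive1E; apply: DeriveDef => //; exact: d.
Qed.

Lemma inv_on_is_derive x : I x -> is_derive (T x) (1 : R) S (derive1 T x)^-1.
Proof.
move=> Ix; have nI : \forall y \near x, I y.
  by apply: open_nbhs_nbhs; split => //; case: oI.
apply: is_derive_inverse.
- by apply: filterS nI => y; exact: inv_onK.
- apply: filterS nI => y /homeo_derive[d _].
  by apply: differentiable_continuous; exact/derivable1_diffP.
- exact: homeo_derive.
- exact: T0.
Qed.

Lemma inv_on_derive y : J y -> is_derive y (1 : R) S (S' y).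
Proof.
move=> /inv_on_sub[ISy TSy]; have := inv_on_is_derive ISy.
by rewrite TSy => d; rewrite derive1E; apply: DeriveDef => //; case: d.
Qed.

Lemma inv_on_deriveM x : I x -> S' (T x) * derive1 T x = 1.
Proof.
move=> Ix; have [_ d] := inv_on_is_derive Ix.
by rewrite derive1E d mulVf// T0.
Qed.

Lemma homeo_monotone_pair : increasing_on I T \/ decreasing_on I T ->
  monotone_pair I J T S.
Proof.
have [oI' _] := oI; have [oJ' _] := oJ.
move=> mono; split => //.
- by move=> x Ix; split; [exact: homeo_sub|exact: inv_onK].
- exact: inv_on_sub.
case: mono => mono; [left|right]; split.
- move=> x x' Ix Ix'; rewrite le_eqVlt => /predU1P[->//|xx'].
  exact/ltW/mono.
- move=> y y' /inv_on_sub[IS TS] /inv_on_sub[IS' TS'] yy'.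
  rewrite leNgt; apply/negP => /(mono _ _ IS' IS); rewrite TS TS'.
  by rewrite ltNge yy'.
- move=> x x' Ix Ix'; rewrite le_eqVlt => /predU1P[->//|xx'].
  exact/ltW/mono.
- move=> y y' /inv_on_sub[IS TS] /inv_on_sub[IS' TS'] yy'.
  rewrite leNgt; apply/negP => /(mono _ _ IS IS'); rewrite TS TS'.
  by rewrite ltNge yy'.
Qed.

Lemma integral_pospart_setI (A : set R) : measurable A ->
  (\int[mu]_(x in I `&` A) (fp x)%:E = \int[mu]_(x in A) (fp x)%:E)%E.
Proof.
move=> mA; rewrite setIC integral_mkcondr.
have mf := measurable_pospart (density_measurable hf).
apply: ae_eq_integral => //.
- apply: measurable_funTS; apply/(measurable_restrictT _ mI).
  by apply: measurable_funTS; exact/measurable_EFinP.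
- by apply: measurable_funTS; exact/measurable_EFinP.
- move: fI; apply: filterS => x h _; rewrite patchE; case: ifPn => //= xI.
  congr EFin; apply/esym/eqP; apply: contraNT xI => /supp_pospart /h.
  exact: mem_set.
Qed.

Section monotone.
Hypothesis mono : increasing_on I T \/ decreasing_on I T.
Let P := homeo_monotone_pair mono.

Definition transported_density y : R := fp ((S \_ J) y) * jacobian J S' y.
Local Notation h0 := transported_density.

Let mfp : measurable_fun setT fp.
Proof. exact: (measurable_pospart (density_measurable hf)). Qed.

Let mT : measurable_fun I T.
Proof. by have [oI' _] := oI; have [] := derivable_measurable oI' homeo_derive. Qed.

Let mSe : measurable_fun setT (S \_ J).
Proof.
apply/(measurable_restrictT _ mJ).
by have [oJ' _] := oJ; have [] := derivable_measurable oJ' inv_on_derive.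
Qed.

Lemma transported_density_ge0 y : 0 <= h0 y.
Proof. by rewrite mulr_ge0 ?pospart_ge0 ?jacobian_ge0. Qed.

Lemma measurable_transported_density : measurable_fun setT h0.
Proof.
apply: measurable_funM; first exact: measurableT_comp.
by have [oJ' _] := oJ; exact: measurable_jacobian inv_on_derive.
Qed.

Lemma integral_transported_density (B : set R) : measurable B ->
  (\int[mu]_(y in B) (h0 y)%:E = \int[mu]_(x in I `&` T @^-1` B) (fp x)%:E)%E.
Proof.
move=> mB.
pose phi y : \bar R := ((\1_B y)%:E * (fp ((S \_ J) y))%:E)%E.
have mphi : measurable_fun setT phi.
  apply: emeasurable_funM; apply/measurable_EFinP; first exact: measurable_indic.
  exact: measurableT_comp.
have phi0 y : (0 <= phi y)%E by rewrite mule_ge0 ?lee_fin ?pospart_ge0// indicE.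
transitivity (\int[mu]_y (phi y * (jacobian J S' y)%:E))%E.
  rewrite integral_mkcond; apply: eq_integral => y _.
  by rewrite /phi patchE indicE /h0; case: (y \in B); rewrite ?mul1e ?mul0e.
rewrite (monotone_change_of_variables P homeo_derive inv_on_derive
  inv_on_deriveM mphi phi0) [RHS]integral_mkcond.
apply: eq_integral => x _.
rewrite /phi !patchE !indicE in_setI.
have [xI|xI] := boolP (x \in I); rewrite ?mule0//= mule1.
have Ix := set_mem xI.
rewrite (mem_set (homeo_sub Ix)) inv_onK//.
have -> : (x \in T @^-1` B) = (T x \in B) by apply/idP/idP; rewrite !inE.
by case: (T x \in B); rewrite ?mul1e ?mul0e.
Qed.

Lemma pushforward_transported : pushforward_density I T f h0.
Proof.
have mh := measurable_transported_density.
split; first split.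
- exact: mh.
- by apply: aeW => y _; exact: transported_density_ge0.
- rewrite integral_transported_density// preimage_setT integral_pospart_setI//.
  exact: integral_pospartT.
- move=> B mB; rewrite integral_transported_density//.
  by rewrite integral_pospart//; exact: mT.
Qed.

Section any_pushforward.
Variables (h : R -> R) (hh : pushforward_density I T f h).
Local Notation H := (cdf_of h).

Let dh : is_density h. Proof. by case: hh. Qed.

(** Densities of the same law agree almost everywhere. *)
Lemma pushforward_ae : ae_eq mu setT h h0.
Proof.
have mh := density_measurable dh.
have [_ h0E] := pushforward_transported; have [_ hE] := hh.
have : ae_eq mu setT (EFin \o h0) (EFin \o h).
  apply: integral_ae_eq => //.
  - have := integrable_pospart pushforward_transported.1 measurableT.
    rewrite (_ : pospart h0 = h0)//; apply/funext => y.
    by rewrite /pospart max_l// transported_density_ge0.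
  - exact/measurable_EFinP.
  - by move=> E _ mE; rewrite /= h0E// hE.
by apply: filterS => y /(_ Logic.I)[->].
Qed.

Lemma EFin_cdf_pushforward y :
  ((H y)%:E = \int[mu]_(x in I `&` T @^-1` `]-oo, y]) (fp x)%:E)%E.
Proof.
rewrite (EFin_cdf dh) -integral_pospart//; have [_ ->//] := hh.
by rewrite integral_pospart//; exact: mT.
Qed.

Lemma cdf_pushforward_increasing y : increasing_on I T -> J y -> H y = F (S y).
Proof.
move=> inc /inv_on_sub[IS TS].
have : ((H y)%:E = (F (S y))%:E)%E; last by case.
rewrite EFin_cdf_pushforward (EFin_cdf hf) -[RHS]integral_pospart_setI//.
congr (\int[mu]_(x in _) _)%E; apply/seteqP; split => x /= [Ix].
- rewrite /= !in_itv/= => Txy; split => //; rewrite leNgt; apply/negP.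
  by move=> /(inc _ _ IS Ix); rewrite TS ltNge Txy.
- rewrite /= !in_itv/= => xSy; split => //; rewrite leNgt; apply/negP => yTx.
  move: xSy; rewrite le_eqVlt => /predU1P[xS|/(inc _ _ Ix IS)].
    by move: yTx; rewrite xS TS ltxx.
  by rewrite TS ltNge ltW.
Qed.

Lemma cdf_pushforward_decreasing y : decreasing_on I T -> J y -> H y = 1 - F (S y).
Proof.
move=> dec /inv_on_sub[IS TS].
have : ((H y)%:E = (1 - F (S y))%:E)%E; last by case.
rewrite EFin_cdf_pushforward -(integral_pospart_ray hf).
rewrite integral_itv_obnd_cbnd; last first.
  by apply: measurable_funTS; exact/measurable_EFinP.
rewrite -[RHS]integral_pospart_setI//.
congr (\int[mu]_(x in _) _)%E; apply/seteqP; split => x /= [Ix].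
- rewrite /= !in_itv/= andbT => Txy; split => //; rewrite leNgt; apply/negP.
  by move=> /(dec _ _ Ix IS); rewrite TS ltNge Txy.
- rewrite /= !in_itv/= andbT => Syx; split => //; rewrite leNgt; apply/negP => yTx.
  move: Syx; rewrite le_eqVlt => /predU1P[xS|/(dec _ _ IS Ix)].
    by move: yTx; rewrite -xS TS ltxx.
  by rewrite TS ltNge ltW.
Qed.

(** In the increasing case [G] is the identity, in the decreasing case
    [G z = 1 - z]. *)
Lemma Uop_pushforward (G : R -> R) g :
  (forall y, J y -> H y = G (F (S y))) ->
  ae_eq mu setT (Uop h g) (VT I J T (Uop f (fun z => g (G z)))).
Proof.
move=> HE; move: pushforward_ae; apply: filterS => y /(_ Logic.I) hy _.
rewrite /VT /Uop hy /h0 /jacobian !patchE; case: ifPn => yJ.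
  rewrite HE; last exact: set_mem.
  by rewrite sqrtrM ?pospart_ge0// sqrt_pospart rmorphM mulrA.
by rewrite mulr0 sqrtr0 mulr0.
Qed.

End any_pushforward.
End monotone.
End pushforward.

Theorem theorem7 (R : realType) (f : R -> R) (hf : is_density f) :
  (* (i) *)
  [/\ L2_isometry `]0, 1[ setT (Uop f),
      forall g : R -> R[i], L2 `]0, 1[ g ->
        {ae (@lebesgue_measure R), forall x, ~ supp f x -> Uop f g x = 0}
    & pos_density f ->
        L2_unitary `]0, 1[ (supp f) (Uop f) /\
        L2_inverse `]0, 1[ (supp f) (Uop f) (Uinv f)]
  /\
  (* (ii) *)
  [/\ forall g : R -> R[i], unit_vector `]0, 1[ g ->
        is_kernel (fun z => abs2 (g z)) /\
        ae_eq (@lebesgue_measure R) setT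
          (fun x => abs2 (Uop f g x)) (rho (fun z => abs2 (g z)) f),
      [set h : R -> R | exists2 v : R -> R, is_kernel v
         & ae_eq (@lebesgue_measure R) setT h (rho v f)]
      = [set h : R -> R | exists2 g : R -> R[i], unit_vector `]0, 1[ g
         & ae_eq (@lebesgue_measure R) setT h (fun x => abs2 (Uop f g x))],
      forall k : nat, (1 <= k)%N ->
        is_kernel (@w R k) /\
        ae_eq (@lebesgue_measure R) setT
          (rho (w k) f) (fun x => abs2 (psi_ f k x))
    & orthonormal_basis (supp f) (fun k => psi_ f k.+1)]
  /\
  (* (iii) *)
  forall (I J : set R) (T : R -> R),
    open_interval I -> open_interval J ->
    {ae (@lebesgue_measure R), forall x, supp f x -> I x} ->
    diff_homeomorphism I J T ->
    (increasing_on I T -> (forall x, I x -> 0 < derive1 T x) ->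
       (exists h, pushforward_density I T f h) /\
       forall h, pushforward_density I T f h ->
       forall g : R -> R[i], L2 `]0, 1[ g ->
         ae_eq (@lebesgue_measure R) setT (Uop h g) (VT I J T (Uop f g)))
    /\
    (decreasing_on I T -> (forall x, I x -> derive1 T x != 0) ->
       (exists h, pushforward_density I T f h) /\
       forall h, pushforward_density I T f h ->
       forall g : R -> R[i], L2 `]0, 1[ g ->
         ae_eq (@lebesgue_measure R) setT
           (Uop h g) (VT I J T (Uop f (reflection g)))).
Proof.
split; last split.
- split.
  + exact: (Uop_isometry hf measurableT (@subsetT _ _)).
  + move=> g _; apply: aeW => x; rewrite /supp/= => /negP; rewrite -leNgt => fx.
    by rewrite /Uop ler0_sqrtr// mulr0.
  + by move=> pf; split; [exact: Uop_unitary|exact: Uop_inverse].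
- split.
  + move=> g ug; split; first exact: unit_vector_kernel.
    exact: abs2_Uop_rho.
  + exact: rho_kernel_set.
  + move=> k k0; split; first exact: w_kernel.
    move: (abs2_Uop_rho hf (phi k)); apply: filterS => x /(_ Logic.I) E _.
    by rewrite /psi_ E /rho abs2_phi.
  + exact: sine_basis.
- move=> I J T oI oJ fI TIJ; split=> mono dT.
  + have T0 x : I x -> derive1 T x != 0 by move=> /dT/gt_eqF ->.
    split; first by eexists; exact: (pushforward_transported hf oI oJ fI TIJ T0 (or_introl mono)).
    move=> h hh g _.
    apply: (Uop_pushforward hf oI oJ fI TIJ T0 (or_introl mono) hh (G := id)) => y Jy.
    exact: (cdf_pushforward_increasing hf oI fI TIJ hh mono Jy).
  + split; first by eexists; exact: (pushforward_transported hf oI oJ fI TIJ dT (or_intror mono)).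
    move=> h hh g _.
    apply: (Uop_pushforward hf oI oJ fI TIJ dT (or_intror mono) hh
      (G := fun z => 1 - z)) => y Jy.
    exact: (cdf_pushforward_decreasing hf oI fI TIJ hh mono Jy).
Qed.
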